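(* Let $(\mathbf{L},\sigma)$ be an object of the category $\mathcal{B}$, and let $\mathcal{T}$ be the canonical element of the pairing between $U_q(\mathbf{L})^*\simeq U_q(\mathbf{L}^* )$ and $U_q(\mathbf{L})$, regarded as an element of $U_q(\mathbf{L}^* )_{op}\otimes U_q(\mathbf{L})$. Then $$\mathcal{T}=\exp(\zeta_\mu\otimes X^\mu)\,\exp(\eta^i\otimes H_i),$$ with summation over repeated indices.
   Context: Everything is over a ground field $K$ ($\mathbb{R}$ or $\mathbb{C}$), Lie bialgebras are finite-dimensional, and repeated indices are summed. Category $\mathcal{B}$. An object is a Lie bialgebra $\mathbf{L}$ with cobracket $\delta$ and a linear involution $\sigma$ of $\mathbf{L}$ that is an anti-automorphism of the Lie algebra and an automorphism of the Lie coalgebra, such that the $\sigma$-invariant subspace $\mathbf{V}\subset\mathbf{L}$ and the $(-\sigma^* )$-invariant subspace of $\mathbf{L}^*$ are Lie subalgebras (hence commutative). Let $\mathbf{H}$ be the $(-1)$-eigenspace of $\sigma$. In bases $H_i$ of $\mathbf{H}$ and $X^\mu$ of $\mathbf{V}$ this means $$[H_i,H_k]=C^m_{ik}H_m,\quad [H_i,X^\mu]=A_{i\nu}^{\;\mu}X^\nu,\quad [X^\mu,X^\nu]=0,$$ $$\delta(X^\mu)=\gamma^\mu_{\rho\sigma}X^\rho\otimes X^\sigma,\quad \delta(H_i)=\alpha_{\rho i}^{\;k}(X^\rho\otimes H_k-H_k\otimes X^\rho).$$ Quantization. $(\alpha\cdot X)^k_i=\alpha_{\rho i}^{\;k}X^\rho$,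 and $D$ is the Campbell–Hausdorff series of the Lie algebra $\mathbf{V}^*$ with structure constants $\gamma^\mu_{\rho\sigma}$. For $\mathbf{L}$ in $\mathcal{B}$, $U_q(\mathbf{L})$ is the unique Hopf algebra generated by $K[[X^\mu]]$ and the $H_i$, equal to $K[[X^\mu]]\otimes U(\mathbf{H})$ as a linear space, with coproduct (in the tensor product completed in the $X$-variables) $$\Delta(X^\mu)=D^\mu(X\otimes 1,1\otimes X),\qquad \Delta(H_i)=(e^{\alpha\cdot X})^k_i\otimes H_k+H_i\otimes 1,$$ and relations $[X^\mu,X^\nu]=0$, $[H_i,H_k]=C(X)^m_{ik}H_m$, $[H_i,X^\mu]=A(X)_i^\mu$ with formal power series $C(X),A(X)$ satisfying $C(0)^m_{ik}=C^m_{ik}$ and $\partial A(0)_i^\mu/\partial X^\nu=A_{i\nu}^{\;\mu}$. Its counit vanishes on $H_i$ and $X^\mu$. Dual. $U_q(\mathbf{L})^*$ is the space of linear functionals on $U_q(\mathbf{L})$ continuous in the $X$-adic topology, with product dual to the coproduct and coproduct dual to the product of $U_q(\mathbf{L})$; it is identified with $U_q(\mathbf{L}^* )$, where $\mathbf{L}^*$ is an object of $\mathcal{B}$ with involution $-\sigma^*$. Let $(H_{i_1},\dots,H_{i_m})$ denote symmetrized monomials. The generator $\eta^i$ is the functional equal to $1$ on $H_i$ and to $0$ on all other basis elements $X^{\mu_1}\cdots X^{\mu_n}(H_{i_1},\dots,H_{i_m})$; $\zeta_\mu$ is the functional equal to $1$ on $X^\mu$ and to $0$ on all other such elements. $U_q(\mathbf{L}^*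 )_{op}$ is $U_q(\mathbf{L}^* )$ with the opposite multiplication; the products in the exponentials are taken in $U_q(\mathbf{L}^* )_{op}\otimes U_q(\mathbf{L})$ completed with respect to the variables $\eta^i$ and $X^\mu$. The canonical element is $\sum_a e^a\otimes e_a$ for dual bases $e_a$ of $U_q(\mathbf{L})$ and $e^a$ of its dual; it is characterized by $\langle \mathcal{T}, u\otimes\mathrm{id}\rangle=u$ for $u\in U_q(\mathbf{L})$. *)

(* Defs.v *)
(* MathComp, with the classical axioms of mathcomp.classical. *)
From HB Require Import structures.
From mathcomp Require Import all_boot all_order all_algebra all_fingroup.
From mathcomp Require Import boolp classical_sets functions reals complex.
Set Implicit Arguments.
Unset Strict Implicit.
Unset Printing Implicit Defensive.
Import Order.TTheory GRing.Theory.
Local Open Scope ring_scope.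
Local Obligation Tactic := idtac.

Variant ground := RealNumbers | ComplexNumbers.

Definition ground_field (R : realType) (k : ground) : fieldType :=
  if k is RealNumbers then R else R[i].

Section Adic.
Variables (K : fieldType) (A : algType K) (I : Type) (x : I -> A).

(* [adic n] is the n-th power of the two-sided ideal generated by the x_i. *)
Inductive adic : nat -> A -> Prop :=
| adic_all a : adic 0 a
| adic_gen n a i c : adic n c -> adic n.+1 (a * x i * c)
| adic_zero n : adic n.+1 0
| adic_add n a b : adic n.+1 a -> adic n.+1 b -> adic n.+1 (a + b).

Lemma adic0 n : adic n 0.
Proof. by case: n => [|n]; constructor. Qed.

Lemma adicD n a b : adic n a -> adic n b -> adic n (a + b).
Proof. by case: n => [|n] ha hb; [exact: adic_all | exact: adic_add]. Qed.

Lemma adicMl n a c : adic n c -> adic n (a * c).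
Proof.
move=> h; elim: h a => {n c}.
- by move=> *; exact: adic_all.
- by move=> n b i c hc _ a; rewrite !mulrA; apply: adic_gen.
- by move=> n a; rewrite mulr0; exact: adic0.
- by move=> n b c _ hb _ hc a; rewrite mulrDr; apply: adicD.
Qed.

Lemma adicMr n a c : adic n c -> adic n (c * a).
Proof.
move=> h; elim: h a => {n c}.
- by move=> *; exact: adic_all.
- by move=> n b i c _ hc a; rewrite -mulrA; apply: adic_gen.
- by move=> n a; rewrite mul0r; exact: adic0.
- by move=> n b c _ hb _ hc a; rewrite mulrDl; apply: adicD.
Qed.

Lemma adicS n a : adic n.+1 a -> adic n a.
Proof.
move En : n.+1 => m h; elim: h n En => {m a} //.
- by move=> n b i c hc _ m [->]; rewrite -mulrA; do 2!apply: adicMl.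
- by move=> n m _; exact: adic0.
- by move=> n a b _ ha _ hb m [E]; apply: adicD; [apply: ha|apply: hb]; rewrite E.
Qed.

Lemma adicW m n a : (m <= n)%N -> adic n a -> adic m a.
Proof.
move=> /subnK <-; elim: (n - m)%N => [//|k IH]; rewrite addSn => /adicS; exact: IH.
Qed.

Definition kills (n : nat) (f : A -> K) := forall a, adic n a -> f a = 0.

Lemma killsW m n f : (m <= n)%N -> kills m f -> kills n f.
Proof. by move=> mn h a ha; apply: h; apply: adicW ha. Qed.

(* Linear functionals continuous for the adic topology, K being discrete (the
   usual topology of K gives the same ones, as the basic neighbourhoods of 0
   in A are subspaces). *)
Record cdual := CDual {
  cfun :> A -> K;
  cfun_linear : scalar cfun;
  cfun_cont : exists n, kills n cfun }.

Lemma cdual_ext (f g : cdual) : f =1 g -> f = g.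
Proof.
case: f g => f lf cf [g lg cg] /= /funext E; subst g.
by rewrite (Prop_irrelevance lf lg) (Prop_irrelevance cf cg).
Qed.

Lemma cfunD (f : cdual) a b : f (a + b) = f a + f b.
Proof. by have := cfun_linear f 1 a b; rewrite scale1r mul1r. Qed.

Lemma cfun0 (f : cdual) : f 0 = 0.
Proof. by apply: (addrI (f 0)); rewrite -cfunD !addr0. Qed.

Lemma cfunZ (f : cdual) c a : f (c *: a) = c * f a.
Proof. by have := cfun_linear f c a 0; rewrite cfun0 !addr0. Qed.

Lemma cfun_sum (f : cdual) (J : Type) (r : seq J) (F : J -> A) :
  f (\sum_(j <- r) F j) = \sum_(j <- r) f (F j).
Proof. by apply: (big_morph f (cfunD f) (cfun0 f)). Qed.

HB.instance Definition _ := gen_eqMixin cdual.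
HB.instance Definition _ := gen_choiceMixin cdual.

Program Definition cdual_zero := @CDual (fun=> 0) _ _.
Next Obligation. by move=> c a b; rewrite mulr0 addr0. Qed.
Next Obligation. by exists 0%N. Qed.

Program Definition cdual_add (f g : cdual) := @CDual (fun a => f a + g a) _ _.
Next Obligation.
by move=> f g c a b; rewrite !cfunD !cfunZ mulrDr addrACA.
Qed.
Next Obligation.
move=> f g; have [[n hn] [m hm]] := (cfun_cont f, cfun_cont g).
exists (maxn n m) => a ha.
by rewrite (killsW (leq_maxl n m) hn) // (killsW (leq_maxr n m) hm) // addr0.
Qed.

Program Definition cdual_scale (c : K) (f : cdual) := @CDual (fun a => c * f a) _ _.
Next Obligation.
by move=> c f d a b; rewrite cfunD cfunZ mulrDr mulrCA.
Qed.
Next Obligation.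
by move=> c f; have [n hn] := cfun_cont f; exists n => a ha; rewrite hn ?mulr0.
Qed.

Definition cdual_opp f := cdual_scale (-1) f.

Lemma cdual_addA : associative cdual_add.
Proof. by move=> f g h; apply: cdual_ext => a /=; rewrite addrA. Qed.
Lemma cdual_addC : commutative cdual_add.
Proof. by move=> f g; apply: cdual_ext => a /=; rewrite addrC. Qed.
Lemma cdual_add0 : left_id cdual_zero cdual_add.
Proof. by move=> f; apply: cdual_ext => a /=; rewrite add0r. Qed.
Lemma cdual_addN : left_inverse cdual_zero cdual_opp cdual_add.
Proof. by move=> f; apply: cdual_ext => a /=; rewrite mulN1r addNr. Qed.
HB.instance Definition _ :=
  GRing.isZmodule.Build cdual cdual_addA cdual_addC cdual_add0 cdual_addN.

Lemma cdual_scaleA c d f : cdual_scale c (cdual_scale d f) = cdual_scale (c * d) f.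
Proof. by apply: cdual_ext => a /=; rewrite mulrA. Qed.
Lemma cdual_scale1 : left_id 1 cdual_scale.
Proof. by move=> f; apply: cdual_ext => a /=; rewrite mul1r. Qed.
Lemma cdual_scaleDr : right_distributive cdual_scale +%R.
Proof. by move=> c f g; apply: cdual_ext => a /=; rewrite mulrDr. Qed.
Lemma cdual_scaleDl f : {morph cdual_scale^~ f : c d / c + d}.
Proof. by move=> c d; apply: cdual_ext => a /=; rewrite mulrDl. Qed.
HB.instance Definition _ := GRing.Zmodule_isLmodule.Build K cdual
  cdual_scaleA cdual_scale1 cdual_scaleDr cdual_scaleDl.

Lemma cdual_sumE (J : Type) (r : seq J) (F : J -> cdual) a :
  (\sum_(j <- r) F j : cdual) a = \sum_(j <- r) F j a.
Proof. by apply: (big_morph (fun f : cdual => f a)). Qed.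

Program Definition cdual_rmul (f : cdual) (c : A) := @CDual (fun a => f (a * c)) _ _.
Next Obligation. by move=> f c d a b; rewrite mulrDl -scalerAl cfunD cfunZ. Qed.
Next Obligation.
by move=> f c; have [n hn] := cfun_cont f; exists n => a ha; apply: hn; apply: adicMr.
Qed.

Program Definition cdual_lmul (f : cdual) (c : A) := @CDual (fun a => f (c * a)) _ _.
Next Obligation. by move=> f c d a b; rewrite mulrDr -scalerAr cfunD cfunZ. Qed.
Next Obligation.
by move=> f c; have [n hn] := cfun_cont f; exists n => a ha; apply: hn; apply: adicMl.
Qed.

Lemma kills_rmul n (f : cdual) c : kills n f -> kills n (cdual_rmul f c).
Proof. by move=> h a ha; apply: h; apply: adicMr. Qed.
Lemma kills_lmul n (f : cdual) c : kills n f -> kills n (cdual_lmul f c).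
Proof. by move=> h a ha; apply: h; apply: adicMl. Qed.

End Adic.

Definition sums_to (V : zmodType) (nb : nat -> V -> Prop) (u : nat -> V) (s : V) :=
  forall n, exists N, forall M, (N <= M)%N -> nb n (s - \sum_(k < M) u k).

Section CompletedTensor.
Variables (K : fieldType) (A B : algType K) (I J : Type) (x : I -> A) (y : J -> B).
Implicit Types (f : cdual x) (g : cdual y).

(* A functional f killing the n-th power of the ideal (x) is a functional on
   A/(x)^n, so the bilinear form t restricted to such pairs (f, g) is an
   element of A/(x)^n (x) B/(y)^n as soon as it is given by a finite formal
   tensor s. *)
Definition approx (n : nat) (t : cdual x -> cdual y -> K) (s : seq (A * B)) :=
  forall f g, kills x n f -> kills y n g -> t f g = \sum_(p <- s) f p.1 * g p.2.

(* The projective limit of the A/(x)^n (x) B/(y)^n, i.e. the completion of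
   A (x) B with respect to the x_i (x) 1 and 1 (x) y_j, realized inside the
   bilinear forms on the continuous duals. *)
Record ctens := CTens {
  cval :> cdual x -> cdual y -> K;
  cvalP : forall n, exists s, approx n cval s }.

Lemma approxW m n t s : (m <= n)%N -> approx n t s -> approx m t s.
Proof. by move=> mn h f g hf hg; apply: h; apply: killsW mn _. Qed.

Lemma level f g : exists n, kills x n f /\ kills y n g.
Proof.
have [[n hn] [m hm]] := (cfun_cont f, cfun_cont g).
by exists (maxn n m); split; [apply: killsW hn; apply: leq_maxl
                             |apply: killsW hm; apply: leq_maxr].
Qed.

Lemma ctens_ext (t u : ctens) : (forall f g, t f g = u f g) -> t = u.
Proof.
case: t u => t ht [u hu] /= E.
have {}E : t = u by apply/funext => f; apply/funext => g.
by subst u; rewrite (Prop_irrelevance ht hu).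
Qed.

Lemma ctensDl (t : ctens) f f' g : t (f + f') g = t f g + t f' g.
Proof.
have [n [hf hg]] := level f g; have [m [hf' _]] := level f' g.
have [s hs] := cvalP t (maxn n m).
have hgN := killsW (leq_maxl n m) hg.
have hfN := killsW (leq_maxl n m) hf; have hfN' := killsW (leq_maxr n m) hf'.
rewrite !hs // -?big_split /=; last first.
  by move=> a ha /=; rewrite hfN // hfN' // addr0.
by apply: eq_bigr => p _; rewrite -mulrDl.
Qed.

Lemma ctensZl (t : ctens) c f g : t (c *: f) g = c * t f g.
Proof.
have [n [hf hg]] := level f g; have [s hs] := cvalP t n.
rewrite !hs // ?mulr_sumr; last by move=> a ha /=; rewrite hf // mulr0.
by apply: eq_bigr => p _; rewrite mulrA.
Qed.

Lemma ctensDr (t : ctens) f g g' : t f (g + g') = t f g + t f g'.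
Proof.
have [n [hf hg]] := level f g; have [m [_ hg']] := level f g'.
have [s hs] := cvalP t (maxn n m).
have hfN := killsW (leq_maxl n m) hf.
have hgN := killsW (leq_maxl n m) hg; have hgN' := killsW (leq_maxr n m) hg'.
rewrite !hs // -?big_split /=; last first.
  by move=> a ha /=; rewrite hgN // hgN' // addr0.
by apply: eq_bigr => p _; rewrite -mulrDr.
Qed.

Lemma ctensZr (t : ctens) c f g : t f (c *: g) = c * t f g.
Proof.
have [n [hf hg]] := level f g; have [s hs] := cvalP t n.
rewrite !hs // ?mulr_sumr; last by move=> a ha /=; rewrite hg // mulr0.
by apply: eq_bigr => p _; rewrite mulrCA.
Qed.

HB.instance Definition _ := gen_eqMixin ctens.
HB.instance Definition _ := gen_choiceMixin ctens.

Program Definition ptensor (a : A) (b : B) := @CTens (fun f g => f a * g b) _.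
Next Obligation. by move=> a b n; exists [:: (a, b)] => f g _ _; rewrite big_seq1. Qed.

Program Definition ctens_zero := @CTens (fun _ _ => 0) _.
Next Obligation. by move=> n; exists [::] => f g _ _; rewrite big_nil. Qed.

Program Definition ctens_add (t u : ctens) := @CTens (fun f g => t f g + u f g) _.
Next Obligation.
move=> t u n; have [[s hs] [r hr]] := (cvalP t n, cvalP u n).
by exists (s ++ r) => f g hf hg; rewrite big_cat hs // hr.
Qed.

Program Definition ctens_scale (c : K) (t : ctens) := @CTens (fun f g => c * t f g) _.
Next Obligation.
move=> c t n; have [s hs] := cvalP t n.
exists [seq (c *: p.1, p.2) | p <- s] => f g hf hg.
by rewrite big_map hs // mulr_sumr; apply: eq_bigr => p _; rewrite cfunZ mulrA.
Qed.

Definition ctens_opp t := ctens_scale (-1) t.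

Lemma ctens_addA : associative ctens_add.
Proof. by move=> t u v; apply: ctens_ext => f g /=; rewrite addrA. Qed.
Lemma ctens_addC : commutative ctens_add.
Proof. by move=> t u; apply: ctens_ext => f g /=; rewrite addrC. Qed.
Lemma ctens_add0 : left_id ctens_zero ctens_add.
Proof. by move=> t; apply: ctens_ext => f g /=; rewrite add0r. Qed.
Lemma ctens_addN : left_inverse ctens_zero ctens_opp ctens_add.
Proof. by move=> t; apply: ctens_ext => f g /=; rewrite mulN1r addNr. Qed.
HB.instance Definition _ :=
  GRing.isZmodule.Build ctens ctens_addA ctens_addC ctens_add0 ctens_addN.

Lemma ctens_scaleA c d t : ctens_scale c (ctens_scale d t) = ctens_scale (c * d) t.
Proof. by apply: ctens_ext => f g /=; rewrite mulrA. Qed.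
Lemma ctens_scale1 : left_id 1 ctens_scale.
Proof. by move=> t; apply: ctens_ext => f g /=; rewrite mul1r. Qed.
Lemma ctens_scaleDr : right_distributive ctens_scale +%R.
Proof. by move=> c t u; apply: ctens_ext => f g /=; rewrite mulrDr. Qed.
Lemma ctens_scaleDl t : {morph ctens_scale^~ t : c d / c + d}.
Proof. by move=> c d; apply: ctens_ext => f g /=; rewrite mulrDl. Qed.
HB.instance Definition _ := GRing.Zmodule_isLmodule.Build K ctens
  ctens_scaleA ctens_scale1 ctens_scaleDr ctens_scaleDl.

Definition prod_seq (s r : seq (A * B)) := [seq (p.1 * q.1, p.2 * q.2) | p <- s, q <- r].

(* (a (x) b)(c (x) d) = ac (x) bd, computed on finite approximations; by
   [approx_mul] the choices do not matter. *)
Definition ctens_mul_val (t u : ctens) (f : cdual x) (g : cdual y) : K :=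
  let n := sval (cid (level f g)) in
  \sum_(p <- prod_seq (sval (cid (cvalP t n))) (sval (cid (cvalP u n)))) f p.1 * g p.2.

Lemma prod_seq_valL n (t : ctens) s r f g :
  approx n t s -> kills x n f -> kills y n g ->
  \sum_(p <- prod_seq s r) f p.1 * g p.2 =
  \sum_(q <- r) t (cdual_rmul f q.1) (cdual_rmul g q.2).
Proof.
move=> hs hf hg; rewrite big_allpairs_dep exchange_big /=.
by apply: eq_bigr => q _; rewrite hs //; apply: kills_rmul.
Qed.

Lemma prod_seq_valR n (u : ctens) s r f g :
  approx n u r -> kills x n f -> kills y n g ->
  \sum_(p <- prod_seq s r) f p.1 * g p.2 =
  \sum_(p <- s) u (cdual_lmul f p.1) (cdual_lmul g p.2).
Proof.
move=> hs hf hg; rewrite big_allpairs_dep /=.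
by apply: eq_bigr => p _; rewrite hs //; apply: kills_lmul.
Qed.

Lemma approx_mul n (t u : ctens) s r :
  approx n t s -> approx n u r -> approx n (ctens_mul_val t u) (prod_seq s r).
Proof.
move=> hs hr f g hf hg; rewrite /ctens_mul_val.
case: cid => m [hf' hg'] /=; case: cid => s' hs' /=; case: cid => r' hr' /=.
have [S hS] := cvalP t (maxn n m); have [Q hQ] := cvalP u (maxn n m).
have SW k : (k <= maxn n m)%N -> approx k t S /\ approx k u Q.
  by move=> h; split; apply: approxW h _.
have [hS1 hQ1] := SW _ (leq_maxl n m); have [hS2 hQ2] := SW _ (leq_maxr n m).
have swap k s1 r1 : approx k t S -> approx k u Q -> approx k t s1 -> approx k u r1 ->
    kills x k f -> kills y k g ->
    \sum_(p <- prod_seq s1 r1) f p.1 * g p.2 = \sum_(p <- prod_seq S Q) f p.1 * g p.2.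
  move=> h1 h2 h3 h4 h5 h6.
  rewrite (prod_seq_valL _ h3) // -(prod_seq_valL _ h1) //.
  by rewrite (prod_seq_valR _ h4) // -(prod_seq_valR _ h2).
by rewrite (swap m s' r') // (swap n s r).
Qed.

Definition ctens_mul (t u : ctens) : ctens.
Proof.
exists (ctens_mul_val t u) => n; have [[s hs] [r hr]] := (cvalP t n, cvalP u n).
by exists (prod_seq s r); apply: approx_mul.
Defined.

Definition ctens_one := ptensor 1 1.

Lemma approxM n (t u : ctens) s r :
  approx n t s -> approx n u r -> approx n (ctens_mul t u) (prod_seq s r).
Proof. exact: approx_mul. Qed.

Lemma approx_ptensor n a b : approx n (ptensor a b) [:: (a, b)].
Proof. by move=> f g _ _; rewrite big_seq1. Qed.

Lemma ctens_mulA : associative ctens_mul.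
Proof.
move=> t u v; apply: ctens_ext => f g; have [n [hf hg]] := level f g.
have [[[s hs] [r hr]] [q hq]] := (cvalP t n, cvalP u n, cvalP v n).
have hL : approx n (ctens_mul t (ctens_mul u v)) (prod_seq s (prod_seq r q)).
  by apply: approxM => //; apply: approxM.
have hR : approx n (ctens_mul (ctens_mul t u) v) (prod_seq (prod_seq s r) q).
  by apply: approxM => //; apply: approxM.
rewrite hL // hR // !big_allpairs_dep /=; apply: eq_bigr => p _.
by rewrite !big_allpairs_dep /=; do 2!apply: eq_bigr => ? _; rewrite !mulrA.
Qed.

Lemma ctens_mul1 : left_id ctens_one ctens_mul.
Proof.
move=> t; apply: ctens_ext => f g; have [n [hf hg]] := level f g.
have [s hs] := cvalP t n.
rewrite /ctens_one (approxM (approx_ptensor 1 1) hs) // hs // big_allpairs_dep big_seq1.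
by apply: eq_bigr => p _; rewrite !mul1r.
Qed.

Lemma ctens_mulr1 : right_id ctens_one ctens_mul.
Proof.
move=> t; apply: ctens_ext => f g; have [n [hf hg]] := level f g.
have [s hs] := cvalP t n.
rewrite /ctens_one (approxM hs (approx_ptensor 1 1)) // hs // big_allpairs_dep.
by apply: eq_bigr => p _; rewrite big_seq1 !mulr1.
Qed.

Lemma approx_add n (t u : ctens) s r :
  approx n t s -> approx n u r -> approx n (t + u) (s ++ r).
Proof. by move=> hs hr f g hf hg; rewrite big_cat -hs // -hr. Qed.

Lemma ctens_addE (t u : ctens) f g : (t + u) f g = t f g + u f g.
Proof. by []. Qed.

Lemma ctens_mulDl : left_distributive ctens_mul +%R.
Proof.
move=> t u v; apply: ctens_ext => f g; have [n [hf hg]] := level f g.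
have [[[s hs] [r hr]] [q hq]] := (cvalP t n, cvalP u n, cvalP v n).
rewrite (approxM (approx_add hs hr) hq) // ctens_addE (approxM hs hq) // (approxM hr hq) //.
by rewrite !big_allpairs_dep big_cat.
Qed.

Lemma ctens_mulDr : right_distributive ctens_mul +%R.
Proof.
move=> t u v; apply: ctens_ext => f g; have [n [hf hg]] := level f g.
have [[[s hs] [r hr]] [q hq]] := (cvalP t n, cvalP u n, cvalP v n).
rewrite (approxM hs (approx_add hr hq)) // ctens_addE (approxM hs hq) // (approxM hs hr) //.
rewrite !big_allpairs_dep -big_split /=.
by apply: eq_bigr => p _; rewrite big_cat.
Qed.

(* Only a [pzRingType]: 1 (x) 1 vanishes if the x_i generate the unit ideal. *)
HB.instance Definition _ := GRing.Zmodule_isPzRing.Build ctens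
  ctens_mulA ctens_mul1 ctens_mulr1 ctens_mulDl ctens_mulDr.

Definition tnull (n : nat) (t : ctens) :=
  forall f g, kills x n f -> kills y n g -> t f g = 0.

(* 0 if the exponential series of z does not converge. *)
Definition cexp (z : ctens) : ctens :=
  xget 0 [set e | sums_to tnull (fun n => (n`!)%:R^-1 *: z ^+ n) e].

(* (phi (x) id)(t) = b, where phi (x) id is extended by continuity from A (x) B. *)
Definition slice_to (phi : A -> K) (t : ctens) (b : B) :=
  forall n, exists m, forall s, approx m t s ->
    adic y n (b - \sum_(p <- s) phi p.1 *: p.2).

End CompletedTensor.

Notation "a ⊗[ x , y ] b" := (ptensor x y a b) (at level 40, format "a  ⊗[ x ,  y ]  b").

Section Hopf.
Variables (K : fieldType) (A : algType K) (I : Type) (x : I -> A).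

Record comultiplication := Comultiplication {
  comul :> A -> ctens x x;
  comul_linear : linear comul;
  comul_cont : forall n, exists m, forall a, adic x m a -> tnull n (comul a) }.

Program Definition conv (D : comultiplication) (f g : cdual x) : cdual x :=
  @CDual _ _ _ x (fun a => D a f g) _ _.
Next Obligation. by move=> D f g c a b; rewrite comul_linear. Qed.
Next Obligation.
move=> D f g; have [n [hf hg]] := level f g; have [m hm] := comul_cont D n.
by exists m => a ha; apply: hm.
Qed.

(* Coassociativity is evaluated on f (x) g (x) h. *)
Record hopf := Hopf {
  hcomul :> comultiplication;
  counit : cdual x;
  antipode : A -> A;
  comulA : forall a f g h, hcomul a f (conv hcomul g h) = hcomul a (conv hcomul f g) h;
  counitl : forall a f, hcomul a counit f = f a;
  counitr : forall a f, hcomul a f counit = f a;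
  comul1 : hcomul 1 = 1;
  comulM : forall a b, hcomul (a * b) = hcomul a * hcomul b;
  counit1 : counit 1 = 1;
  counitM : forall a b, counit (a * b) = counit a * counit b;
  antipode_linear : linear antipode;
  antipode_cont : forall n, exists m, forall a, adic x m a -> adic x n (antipode a);
  (* the antipode axioms, for the multiplication map extended by continuity *)
  antipodel : forall a n, exists m, forall s, approx m (hcomul a) s ->
    adic x n (\sum_(p <- s) antipode p.1 * p.2 - counit a *: 1);
  antipoder : forall a n, exists m, forall s, approx m (hcomul a) s ->
    adic x n (\sum_(p <- s) p.1 * antipode p.2 - counit a *: 1) }.

Definition hdual (h : hopf) : Type := cdual x.

Section Dual.
Variable h : hopf.
HB.instance Definition _ := GRing.Lmodule.on (hdual h).

Definition hdual_mul (f g : hdual h) : hdual h := conv h f g.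

Lemma hdual_mulA : associative hdual_mul.
Proof. by move=> f g k; apply: cdual_ext => a /=; rewrite comulA. Qed.
Lemma hdual_mul1 : left_id (counit h : hdual h) hdual_mul.
Proof. by move=> f; apply: cdual_ext => a /=; rewrite counitl. Qed.
Lemma hdual_mulr1 : right_id (counit h : hdual h) hdual_mul.
Proof. by move=> f; apply: cdual_ext => a /=; rewrite counitr. Qed.
Lemma hdual_mulDl : left_distributive hdual_mul +%R.
Proof. by move=> f g k; apply: cdual_ext => a /=; rewrite ctensDl. Qed.
Lemma hdual_mulDr : right_distributive hdual_mul +%R.
Proof. by move=> f g k; apply: cdual_ext => a /=; rewrite ctensDr. Qed.
Lemma hdual_one_neq0 : (counit h : hdual h) != 0.
Proof.
apply/eqP => /(congr1 (fun f : cdual x => f 1)); rewrite counit1.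
by move/eqP; rewrite oner_eq0.
Qed.
HB.instance Definition _ := GRing.Zmodule_isNzRing.Build (hdual h)
  hdual_mulA hdual_mul1 hdual_mulr1 hdual_mulDl hdual_mulDr hdual_one_neq0.

Lemma hdual_scalerAl (c : K) (f g : hdual h) : c *: (f * g) = (c *: f) * g.
Proof. by apply: cdual_ext => a /=; rewrite ctensZl. Qed.
HB.instance Definition _ := GRing.Lmodule_isLalgebra.Build K (hdual h) hdual_scalerAl.
Lemma hdual_scalerAr (c : K) (f g : hdual h) : c *: (f * g) = f * (c *: g).
Proof. by apply: cdual_ext => a /=; rewrite ctensZr. Qed.
HB.instance Definition _ := GRing.Lalgebra_isAlgebra.Build K (hdual h) hdual_scalerAr.
End Dual.

End Hopf.

Section Converse.
Variables (K : fieldType) (A : algType K).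
HB.instance Definition _ := GRing.Lmodule.on (A^c)%type.
Lemma converse_scalerAl (c : K) (a b : A^c) : c *: (a * b) = (c *: a : A^c) * b.
Proof. exact: (@scalerAr K A c b a). Qed.
HB.instance Definition _ := GRing.Lmodule_isLalgebra.Build K (A^c)%type converse_scalerAl.
Lemma converse_scalerAr (c : K) (a b : A^c) : c *: (a * b) = a * (c *: b : A^c).
Proof. exact: (@scalerAl K A c b a). Qed.
HB.instance Definition _ := GRing.Lalgebra_isAlgebra.Build K (A^c)%type converse_scalerAr.
End Converse.

(* L (x) L is 'Hom(L^*, L): the pure tensor a (x) b sends xi to xi(a) b. *)
Definition tensor2 (K : fieldType) (L : vectType K) := 'Hom('Hom(L, K^o), L).
Definition ptensor2 (K : fieldType) (L : vectType K) (a b : L) : tensor2 L :=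
  linfun (fun xi : 'Hom(L, K^o) => xi a *: b).

Definition dual_bracket (K : fieldType) (L : vectType K) (D : 'Hom(L, tensor2 L))
    (xi th : 'Hom(L, K^o)) : 'Hom(L, K^o) :=
  linfun (fun a => th (D a xi)).

Record lie_bialgebra (K : fieldType) (L : vectType K) := LieBialgebra {
  bracket : 'Hom(L, 'End(L));
  bracketxx : forall a, bracket a a = 0;
  bracket_jacobi : forall a b c,
    bracket a (bracket b c) + bracket b (bracket c a) + bracket c (bracket a b) = 0;
  cobracket : 'Hom(L, tensor2 L);
  (* the cobracket dualizes to a Lie bracket on L^* *)
  cobracketxx : forall xi, dual_bracket cobracket xi xi = 0;
  cobracket_jacobi : forall xi th om, let br := dual_bracket cobracket in
    br xi (br th om) + br th (br om xi) + br om (br xi th) = 0;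
  (* delta [a, b] = a . delta b - b . delta a, where a acts on L (x) L as
     ad a (x) id + id (x) ad a *)
  cobracket_cocycle : forall a b xi,
    cobracket (bracket a b) xi =
      (cobracket b (xi \o bracket a)%VF + bracket a (cobracket b xi))
      - (cobracket a (xi \o bracket b)%VF + bracket b (cobracket a xi)) }.

Record objB (K : fieldType) (L : vectType K) := ObjB {
  objB_bialg :> lie_bialgebra L;
  invol : 'End(L);
  invol_invol : forall a, invol (invol a) = a;
  invol_bracket : forall a b,
    invol (bracket objB_bialg a b) = bracket objB_bialg (invol b) (invol a);
  (* delta (sigma a) = (sigma (x) sigma) (delta a) *)
  invol_cobracket : forall a xi,
    cobracket objB_bialg (invol a) xi = invol (cobracket objB_bialg a (xi \o invol)%VF);
  inv_subalg : forall a b, a \in fixedSpace invol -> b \in fixedSpace invol ->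
    bracket objB_bialg a b \in fixedSpace invol;
  (* the subspace { xi | - sigma^* xi = xi } of L^* is a Lie subalgebra *)
  coinv_subalg : forall xi th, - (xi \o invol)%VF = xi -> - (th \o invol)%VF = th ->
    let br := dual_bracket (cobracket objB_bialg) xi th in - (br \o invol)%VF = br }.

Definition spaceV (K : fieldType) (L : vectType K) (B : objB L) : {vspace L} :=
  fixedSpace (invol B).
Definition spaceH (K : fieldType) (L : vectType K) (B : objB L) : {vspace L} :=
  lker (invol B + \1)%VF.

(* Bases X^mu of V and H_i of H with the structure constants; the lower indices
   come first: strA i nu mu is A_{i nu}^mu, stra rho i k is alpha_{rho i}^k. *)
Record adapted_basis (K : fieldType) (L : vectType K) (B : objB L) := AdaptedBasis {
  dimV : nat;
  dimH : nat;
  basV : dimV.-tuple L;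
  basH : dimH.-tuple L;
  basVP : basis_of (spaceV B) basV;
  basHP : basis_of (spaceH B) basH;
  strC : 'I_dimH -> 'I_dimH -> 'I_dimH -> K;
  strA : 'I_dimH -> 'I_dimV -> 'I_dimV -> K;
  strg : 'I_dimV -> 'I_dimV -> 'I_dimV -> K;
  stra : 'I_dimV -> 'I_dimH -> 'I_dimH -> K;
  strCE : forall i k, bracket B (tnth basH i) (tnth basH k) =
    \sum_m strC i k m *: tnth basH m;
  strAE : forall i mu, bracket B (tnth basH i) (tnth basV mu) =
    \sum_nu strA i nu mu *: tnth basV nu;
  strgE : forall mu, cobracket B (tnth basV mu) =
    \sum_rho \sum_sig strg rho sig mu *: ptensor2 (tnth basV rho) (tnth basV sig);
  straE : forall i, cobracket B (tnth basH i) =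
    \sum_rho \sum_k stra rho i k *:
      (ptensor2 (tnth basV rho) (tnth basH k) - ptensor2 (tnth basH k) (tnth basV rho)) }.

Definition psr (K : fieldType) (p : nat) := {ffun 'I_p -> nat} -> K^o.

Section PowerSeries.
Variables (K : fieldType) (p : nat).

Definition ps1 : psr K p := fun a => (a == [ffun=> 0%N])%:R.
Definition midx (mu : 'I_p) : {ffun 'I_p -> nat} := [ffun nu => (nu == mu) : nat].
Definition psX (mu : 'I_p) : psr K p := fun a => (a == midx mu)%:R.
Definition psmul (f g : psr K p) : psr K p := fun a =>
  \sum_(b : {ffun 'I_p -> 'I_(\sum_i a i).+1} | [forall i, (b i <= a i)%N])
    f [ffun i => b i : nat] * g [ffun i => a i - b i]%N.

End PowerSeries.

(* Dynkin's formula, for the Lie algebra with structure constants gam extended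
   by the commutative algebra generated by the components of u and v. *)
Section CampbellHausdorff.
Variables (K : fieldType) (A B : algType K) (I J : Type) (x : I -> A) (y : J -> B).
Variables (p : nat) (gam : 'I_p -> 'I_p -> 'I_p -> K).
Local Notation W := (ctens x y).

Definition ch_bracket (u v : 'I_p -> W) : 'I_p -> W := fun mu =>
  \sum_rho \sum_sig gam rho sig mu *: (u rho * v sig).

Fixpoint ch_nested (w : seq ('I_p -> W)) : 'I_p -> W :=
  match w with
  | [::] => fun=> 0
  | [:: u] => u
  | u :: w' => ch_bracket u (ch_nested w')
  end.

(* The part of the series that is homogeneous of degree n in u and v. *)
Definition ch_term (u v : 'I_p -> W) (n : nat) (mu : 'I_p) : W :=
  \sum_(1 <= k < n.+1)
    \sum_(rs : {ffun 'I_k -> 'I_n.+1 * 'I_n.+1} |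
            [forall i, 0 < (rs i).1 + (rs i).2]%N &&
            ((\sum_i ((rs i).1 + (rs i).2))%N == n))
      ((-1) ^+ k.-1 / (k * n * \prod_i ((rs i).1`! * (rs i).2`!))%N%:R) *:
      ch_nested (flatten [seq nseq (rs i).1 u ++ nseq (rs i).2 v | i <- enum 'I_k]) mu.

End CampbellHausdorff.

Definition symmon (K : fieldType) (A : algType K) (q : nat) (h : 'I_q -> A)
    (w : seq 'I_q) : A :=
  ((size w)`!)%:R^-1 *:
    \sum_(s : 'S_(size w)) \prod_(k < size w) h (tnth (in_tuple w) (s k)).

Definition lie_hom (K : fieldType) (q : nat) (C : 'I_q -> 'I_q -> 'I_q -> K)
    (A : algType K) (h : 'I_q -> A) :=
  forall i k, h i * h k - h k * h i = \sum_m C i k m *: h m.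

(* U is the universal enveloping algebra of the Lie algebra with structure
   constants C, the basis of which is mapped to j. *)
Definition enveloping (K : fieldType) (q : nat) (C : 'I_q -> 'I_q -> 'I_q -> K)
    (U : algType K) (j : 'I_q -> U) :=
  [/\ lie_hom C j,
      (forall u, exists s : seq (K * seq 'I_q),
        u = \sum_(w <- s) w.1 *: \prod_(i <- w.2) j i) &
      (forall (A : algType K) (h : 'I_q -> A), lie_hom C h ->
        exists f : {lrmorphism U -> A}, forall i, f (j i) = h i)].

Definition bilin (K : fieldType) (V1 V2 W : lmodType K) (b : V1 -> V2 -> W) :=
  (forall v, linear (b v)) /\ (forall w, linear (b^~ w)).

(* b : V1 x V2 -> W is a tensor product of V1 and V2. *)
Definition is_tensor (K : fieldType) (V1 V2 W : lmodType K) (b : V1 -> V2 -> W) :=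
  [/\ bilin b,
      (forall w, exists s : seq (V1 * V2), w = \sum_(p <- s) b p.1 p.2) &
      (forall (Z : lmodType K) (c : V1 -> V2 -> Z), bilin c ->
        exists g : {linear W -> Z}, forall v1 v2, g (b v1 v2) = c v1 v2)].

Record quantization (K : fieldType) (L : vectType K) (B : objB L)
    (e : adapted_basis B) := Quantization {
  qalg :> algType K;
  qps : {linear psr K (dimV e) -> qalg};
  qps1 : qps (@ps1 K (dimV e)) = 1;
  qpsM : forall f g, qps (psmul f g) = qps f * qps g;
  qX := fun mu => qps (psX K mu);
  qH : 'I_(dimH e) -> qalg;
  (* f (x) u |-> f u identifies K[[X]] (x) U(H) with qalg, where U(H) lies in
     qalg through symmetrization *)
  qenv : algType K;
  qenvH : 'I_(dimH e) -> qenv;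
  qenvP : enveloping (@strC _ _ _ e) qenvH;
  qsym : {linear qenv -> qalg};
  qsymE : forall w, qsym (symmon qenvH w) = symmon qH w;
  qtensor : is_tensor (fun (f : psr K (dimV e)) (u : qenv) => qps f * qsym u);
  qhopf : hopf qX;
  qcounitX : forall mu, counit qhopf (qX mu) = 0;
  qcounitH : forall i, counit qhopf (qH i) = 0;
  qcomulX : forall mu,
    sums_to (@tnull _ _ _ _ _ qX qX)
      (fun n => ch_term (@strg _ _ _ e)
         (fun nu => qX nu ⊗[qX, qX] 1) (fun nu => 1 ⊗[qX, qX] qX nu) n mu)
      (qhopf (qX mu));
  (* the entries of exp (alpha . X) *)
  qexp : 'I_(dimH e) -> 'I_(dimH e) -> psr K (dimV e);
  qexpP : forall i k,
    sums_to (adic qX)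
      (fun n => (n`!)%:R^-1 *:
         ((\matrix_(i', k') \sum_rho stra rho i' k' *: qX rho) ^+ n) i k)
      (qps (qexp i k));
  qcomulH : forall i, qhopf (qH i) =
    \sum_k qps (qexp i k) ⊗[qX, qX] qH k + qH i ⊗[qX, qX] 1;
  qC : 'I_(dimH e) -> 'I_(dimH e) -> 'I_(dimH e) -> psr K (dimV e);
  qC0 : forall i k m, qC i k m [ffun=> 0%N] = strC i k m;
  qHH : forall i k, qH i * qH k - qH k * qH i = \sum_m qps (qC i k m) * qH m;
  qA : 'I_(dimH e) -> 'I_(dimV e) -> psr K (dimV e);
  (* the coefficient of X^nu is the derivative at 0 *)
  qA1 : forall i mu nu, qA i mu (midx nu) = strA i nu mu;
  qHX : forall i mu, qH i * qX mu - qX mu * qH i = qps (qA i mu) }.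

(* U_q(L)^*, identified with U_q(L^* ). *)
Definition qdual (K : fieldType) (L : vectType K) (B : objB L)
  (e : adapted_basis B) (U : quantization e) : algType K := hdual (qhopf U).

(* X^{v_1} .. X^{v_n} (H_{w_1}, .., H_{w_m}), with repetitions when the words
   v and w are permuted. *)
Definition qbasis (K : fieldType) (L : vectType K) (B : objB L)
    (e : adapted_basis B) (U : quantization e)
    (v : seq 'I_(dimV e)) (w : seq 'I_(dimH e)) : U :=
  (\prod_(mu <- v) qX U mu) * symmon (@qH _ _ _ _ U) w.

Definition qpair (K : fieldType) (L : vectType K) (B : objB L)
    (e : adapted_basis B) (U : quantization e) (f : qdual U) (u : U) : K :=
  (f : cdual (qX U)) u.

(* <T, u (x) id> = u for all u, where T lies in (U^* )_op (x) U completed with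
   respect to eta and X. *)
Definition canonical_element (K : fieldType) (L : vectType K) (B : objB L)
    (e : adapted_basis B) (U : quantization e) (I : Type)
    (eta : I -> (qdual U)^c) (T : ctens eta (qX U)) :=
  forall u : U, slice_to (fun f : (qdual U)^c => qpair f u) T u.

(* Main.v *)
From HB Require Import structures.
Require Import Defs.
From mathcomp Require Import all_boot all_algebra all_fingroup.
From mathcomp Require Import boolp classical_sets functions reals complex.

(** Write h for a combination sum t_i H_i. By polarization, and by reordering the
    words in the H, the elements X^v h^n span a dense subspace of the quantized
    algebra ([cdual_ext_monomials]), and everything is computed on them.

    The product of exponentials is canonical. In the dual, with the opposite
    multiplication, a word in the zeta followed by a word in the eta is
    evaluated at X^v h^n by the coproduct, with the eta in the first factor and
    the zeta in the second one. The eta kill the ideal (X), and modulo (X) in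
    the first factor the coproduct leaves X^v in the second factor and makes h
    primitive; so the eta differentiate h^n with respect to t
    ([conv_eta_word]). The zeta kill the left ideal generated by the H
    ([zeta_word_killsUH]), so that all of h^n must have been used up, and the
    zeta are left with X^v. There the coproduct is the Campbell-Hausdorff
    series. The divided powers of the generic element sum zeta_mu (x) X^mu are
    multiplicative ([leibnizP]), and on a generator only the linear part of the
    series counts, because the components of the generic point X commute and
    its brackets with itself vanish; hence they recover X^v ([dpow_Xw]).
    Altogether the truncated product of exponentials, evaluated at X^v h^n, is
    X^v h^n ([expansion_monomial]).

    A canonical element is unique. By definition it is prescribed against the
    evaluations at elements u in the first factor, while an element of the
    completed tensor product is tested against all functionals on the dual that
    are continuous for the powers of the ideal of the eta. The n-th power of
    this ideal vanishes on the elements with fewer than n factors H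
    ([adic_eta_degH]); conversely, a functional that vanishes on these elements
    lies in the n-th power ([adic_eta_converse]), which follows from Euler's
    formula for homogeneous polynomials in t. So the evaluations are enough. *)

Set Implicit Arguments.
Unset Strict Implicit.
Unset Printing Implicit Defensive.
Import GRing.Theory.
Local Open Scope ring_scope.

(** * Linear spans and sums over words *)

Section Span.
Variables (K : fieldType) (V : lmodType K).
Implicit Type G : V -> Prop.

Inductive span G : V -> Prop :=
| span_nil : span G 0
| span_cons c g v : G g -> span G v -> span G (c *: g + v).

Lemma span_gen G g : G g -> span G g.
Proof. by move=> /(span_cons 1)/(_ (span_nil G)); rewrite scale1r addr0. Qed.

Lemma spanD G u v : span G u -> span G v -> span G (u + v).
Proof.
by move=> hu hv; elim: hu => [|c g w hg _ IH]; rewrite ?add0r // -addrA; constructor.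
Qed.

Lemma spanZ G c v : span G v -> span G (c *: v).
Proof.
elim=> [|d g w hg _ IH]; first by rewrite scaler0; constructor.
by rewrite scalerDr scalerA; constructor.
Qed.

Lemma span_sum G (J : Type) (r : seq J) (P : pred J) (F : J -> V) :
  (forall j, P j -> span G (F j)) -> span G (\sum_(j <- r | P j) F j).
Proof. by move=> h; apply: big_ind => //; [exact: span_nil | exact: spanD]. Qed.

End Span.

Lemma span_map (K : fieldType) (V W : lmodType K) (f : V -> W) G (G' : W -> Prop) v :
  linear f -> (forall g, G g -> span G' (f g)) -> span G v -> span G' (f v).
Proof.
move=> lf hG; elim=> [|c g w hg _ IH].
  by have := lf (-1) 0 0; rewrite scaler0 addr0 scaleN1r addNr => ->; exact: span_nil.
by rewrite lf; apply: spanD => //; apply/spanZ/hG.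
Qed.

Lemma span_sub (K : fieldType) (V : lmodType K) (G G' : V -> Prop) v :
  (forall g, G g -> span G' g) -> span G v -> span G' v.
Proof. by move=> h; apply: (@span_map _ _ _ id). Qed.

Lemma span_mull (K : fieldType) (A : algType K) (G G' : A -> Prop) a b :
  (forall g, G g -> span G' (a * g)) -> span G b -> span G' (a * b).
Proof. by apply: (@span_map _ _ _ ( *%R a)) => c x y; rewrite mulrDr scalerAr. Qed.

Lemma sum_tupleS (V : nmodType) (T : finType) m (F : seq T -> V) :
  \sum_(w : m.+1.-tuple T) F w = \sum_i \sum_(w : m.-tuple T) F (i :: w).
Proof.
rewrite pair_big /= (reindex (fun q : T * m.-tuple T => [tuple of q.1 :: q.2])) //=.
exists (fun w : m.+1.-tuple T => (thead w, [tuple of behead w])) => [[i w] _ | w _] /=.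
  by congr (_, _); apply: val_inj.
by rewrite -tuple_eta.
Qed.

Lemma sum_tuple0 (V : nmodType) (T : finType) (F : seq T -> V) :
  \sum_(w : 0.-tuple T) F w = F [::].
Proof.
rewrite (big_pred1 [tuple]) // => w; symmetry; apply/eqP.
by rewrite [w]tuple0; apply: val_inj.
Qed.

Lemma expr_sum_tuple (A : pzRingType) (T : finType) (a : T -> A) m :
  (\sum_i a i) ^+ m = \sum_(w : m.-tuple T) \prod_(i <- w) a i.
Proof.
elim: m => [|m IH]; first by rewrite expr0 (@sum_tuple0 _ _ (fun w => \prod_(i <- w) a i)) big_nil.
rewrite (@sum_tupleS _ _ _ (fun w => \prod_(i <- w) a i)) exprS IH mulr_suml.
by apply: eq_bigr => i _; rewrite mulr_sumr; apply: eq_bigr => w _; rewrite big_cons.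
Qed.

Lemma prod_scale (K : fieldType) (A : algType K) (I : Type) (t : I -> K) (a : I -> A) w :
  \prod_(i <- w) (t i *: a i) = (\prod_(i <- w) t i) *: \prod_(i <- w) a i.
Proof.
elim: w => [|i w IH]; first by rewrite !big_nil scale1r.
by rewrite !big_cons IH -scalerAl -scalerAr scalerA.
Qed.

Lemma prod_mktuple (A : pzRingType) (T : Type) m (f : 'I_m -> T) (F : T -> A) :
  \prod_(i <- mktuple f) F i = \prod_k F (f k).
Proof. by rewrite (big_tuple _ _ (mktuple f)); apply: eq_bigr => k _; rewrite tnth_mktuple. Qed.

(** * Symmetrized words *)

Section Words.
Variables (K : fieldType) (A : algType K) (q : nat) (h : 'I_q -> A).
Hypothesis char0 : forall n, n.+1%:R != 0 :> K.
Local Notation word w := (\prod_(i <- w) h i).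

Definition lcomb (t : 'I_q -> K) : A := \sum_i t i *: h i.

Lemma fact_neq0 n : n`!%:R != 0 :> K.
Proof. by case: n`! (fact_gt0 n) => // n' _; apply: char0. Qed.

Lemma symmonE m (w : m.-tuple 'I_q) :
  symmon h w = (m`!%:R)^-1 *: \sum_(s : 'S_m) \prod_(k < m) h (tnth w (s k)).
Proof.
case: w => w /= sz; move: (sz); rewrite -(eqP sz) => {m sz} sz.
rewrite /symmon; congr (_ *: _); apply: eq_bigr => s _; apply: eq_bigr => k _.
by have x0 := tnth (in_tuple w) k; congr h; rewrite !(tnth_nth x0).
Qed.

Lemma lcombX_words t m :
  lcomb t ^+ m = \sum_(w : m.-tuple 'I_q) (\prod_(i <- w) t i) *: \prod_(i <- w) h i.
Proof. by rewrite expr_sum_tuple; apply: eq_bigr => w _; rewrite prod_scale. Qed.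

(** The letters of the words that occur in the expansion of a power can be
    permuted, so each word can be replaced by its symmetrization. *)
Lemma lcombX_symmon t m :
  lcomb t ^+ m = \sum_(w : m.-tuple 'I_q) (\prod_(i <- w) t i) *: symmon h w.
Proof.
under eq_bigr => w _ do rewrite symmonE scalerA mulrC -scalerA scaler_sumr.
rewrite -scaler_sumr exchange_big /=.
rewrite (eq_bigr (fun=> lcomb t ^+ m)) => [|s _].
  by rewrite sumr_const card_Sn -scaler_nat scalerA mulVf ?scale1r ?fact_neq0.
rewrite lcombX_words; symmetry.
rewrite (reindex (fun w : m.-tuple 'I_q => [tuple tnth w (s k) | k < m])) /=; last first.
  exists (fun w : m.-tuple 'I_q => [tuple tnth w ((s^-1)%g k) | k < m]) => w _;
    by apply: eq_from_tnth => k; rewrite !tnth_mktuple ?permKV ?permK.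
apply: eq_bigr => w _; rewrite !prod_mktuple big_tuple; congr (_ *: _).
by rewrite [RHS](reindex_inj (@perm_inj _ s)).
Qed.

(** Polarization: the symmetrization of n letters a_k is, up to a scalar, the
    alternating sum over the sets S of indices of the powers
    (sum of the a_k for k in S) ^ n. When the powers are expanded, a choice of n
    letters gets the signs of all the S that contain it, and these add up to 0
    unless the choice is a permutation. *)
Lemma symmon_powers w : span (fun a => exists t, a = lcomb t ^+ size w) (symmon h w).
Proof.
set n := size w; pose a k := h (tnth (in_tuple w) k).
pose sgn (S : {set 'I_n}) (f : {ffun 'I_n -> 'I_n}) : K :=
  \prod_i (if i \in S then 1 else - (i \notin codom f)%:R).
have sgnE f : \sum_(S : {set 'I_n}) sgn S f = (injectiveb f)%:R.
  rewrite -(bigA_distr 1 +%R).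
  have [/injectiveP fi|nfi] := boolP (injectiveb f).
    rewrite big1 // => i _; have -> : i \in codom f; last by rewrite /= mulr0n oppr0 addr0.
    by apply/codomP; have [g gK Kg] := injF_bij fi; exists (g i); rewrite Kg.
  have /existsP[i hi] : [exists i, i \notin codom f].
    apply: contraNT nfi; rewrite negb_exists => /forallP hf.
    apply/injectiveP; suff fi : {in 'I_n &, injective f} by move=> x y; apply: fi.
    by apply/image_injP/eqP/eq_card => i; have := hf i; rewrite negbK => ->.
  by rewrite (bigD1 i) //= hi subrr mul0r.
have sgnS (S : {set 'I_n}) :
    exists c : K, forall f : {ffun 'I_n -> 'I_n}, (forall i, f i \in S) -> sgn S f = c.
  exists ((-1) ^+ #|~: S|) => f hf.
  rewrite /sgn (bigID (mem S)) /= big1 ?mul1r => [|i ->//].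
  rewrite (eq_bigr (fun=> -1)) => [|i nS]; last first.
    rewrite (negbTE nS); case: codomP => // -[j ij]; move: nS.
    by rewrite ij hf.
  by rewrite prodr_const; congr (_ ^+ _); apply: eq_card => i; rewrite !inE.
rewrite /symmon; apply: spanZ.
have -> : \sum_(s : 'S_n) \prod_(k < n) h (tnth (in_tuple w) (s k)) =
   \sum_(f : {ffun 'I_n -> 'I_n}) (injectiveb f)%:R *: \prod_k a (f k).
  rewrite [RHS](bigID (fun f : {ffun 'I_n -> 'I_n} => injectiveb f)) /=.
  rewrite [X in _ + X]big1 ?addr0; last first.
    by move=> f /negbTE->; rewrite scale0r.
  rewrite [RHS](reindex (fun s : 'S_n => pval s)) /=; last first.
    exists (fun f => insubd (1%g : 'S_n) f) => [s _|f fi]; first exact: valKd.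
    by apply: (@insubdK _ _ 'S_n).
  apply: eq_big => s; first by rewrite (valP s).
  by move=> _; rewrite (valP s) scale1r; apply: eq_bigr => k _; rewrite pvalE.
under eq_bigr => f _ do rewrite -sgnE scaler_suml.
rewrite exchange_big /=; apply: span_sum => S _.
have [c hc] := sgnS S.
have -> : \sum_(f : {ffun 'I_n -> 'I_n}) sgn S f *: \prod_k a (f k) =
          c *: (\sum_(k in S) a k) ^+ n.
  rewrite -[n in _ ^+ n]card_ord -prodr_const bigA_distr_big /= scaler_sumr.
  rewrite (bigID (fun f : {ffun 'I_n -> 'I_n} => f \in ffun_on (mem S))) /=.
  rewrite [X in _ + X]big1 ?addr0; last first.
    move=> f /ffun_onP hf; rewrite /sgn.
    have [i hi] : exists i, f i \notin S.
      apply/existsP; apply: contra_notT hf; rewrite negb_exists => /forallP hS i.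
      by have := hS i; rewrite negbK.
    by rewrite (bigD1 (f i)) //= (negbTE hi) codom_f /= oppr0 mul0r scale0r.
  by apply: eq_bigr => f /ffun_onP hf; rewrite (hc f).
apply/spanZ/span_gen; exists (fun i => \sum_(k in S) (tnth (in_tuple w) k == i)%:R).
congr (_ ^+ _); rewrite /lcomb.
under [RHS]eq_bigr => i _ do rewrite scaler_suml.
rewrite exchange_big; apply: eq_bigr => k _ /=.
rewrite (bigD1 (tnth (in_tuple w) k)) //= eqxx scale1r big1 ?addr0 // => i /negbTE.
by rewrite eq_sym => ->; rewrite scale0r.
Qed.

Lemma word_cat w1 w2 : word (w1 ++ w2) = word w1 * word w2.
Proof. exact: big_cat. Qed.

(** Sorting by adjacent transpositions: words that are permutations of each
    other agree modulo the differences made by a single exchange. *)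
Lemma word_perm (G : A -> Prop) (n : nat) :
  (forall w1 w2 i k, (size w1 + size w2).+2 = n ->
     span G (word w1 * (h i * h k - h k * h i) * word w2)) ->
  forall w w', size w = n -> perm_eq w w' -> span G (word w - word w').
Proof.
move=> hG; suff H w w' c : (size c + size w)%N = n -> perm_eq w w' ->
    span G (word (c ++ w) - word (c ++ w')).
  by move=> w w' sw; apply: (H w w' [::]).
elim: w w' c => [|i w IH] w' c sz.
  by move/perm_size/esym/size0nil->; rewrite subrr; exact: span_nil.
move=> pw; have /splitPr iw' : i \in w' by rewrite -(perm_mem pw) mem_head.
case: iw' pw => a b pw.
have {}pw : perm_eq w (a ++ b).
  by rewrite -(perm_cons i); apply: perm_trans pw _; rewrite (perm_catCA a [:: i] b).
have {IH}h1 : span G (word (c ++ i :: w) - word (c ++ i :: a ++ b)).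
  by rewrite -!cat_rcons; apply: IH pw; rewrite size_rcons addSnnS.
have sza : (size c + (size a + size b).+1)%N = n by rewrite -size_cat -(perm_size pw).
have h2 : span G (word (c ++ i :: a ++ b) - word (c ++ a ++ i :: b)).
  elim: a c sza {h1 sz pw} => [|k a IH] c sz; first by rewrite subrr; exact: span_nil.
  have := IH (rcons c k); rewrite size_rcons addSnnS !cat_rcons => /(_ sz) {}IH.
  rewrite -[X in span G X](subrKA (word (c ++ k :: i :: a ++ b))) /=.
  apply: spanD => //.
  rewrite !(word_cat c) !big_cons -mulrBr !mulrA -mulrBl mulrA.
  by apply: hG; rewrite -sz !addnS size_cat.
by rewrite -[X in span G X](subrKA (word (c ++ i :: a ++ b))); apply: spanD.
Qed.


Lemma word_symmon (G : A -> Prop) w :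
  (forall w1 w2 i k, (size w1 + size w2).+2 = size w ->
     span G (word w1 * (h i * h k - h k * h i) * word w2)) ->
  span G (word w - symmon h w).
Proof.
move=> hG; set n := size w in hG *.
have -> : word w - symmon h w =
    (n`!%:R)^-1 *: \sum_(s : 'S_n) (word w - word (mktuple (fun k => tnth (in_tuple w) (s k)))).
  rewrite sumrB sumr_const card_Sn scalerBr -scaler_nat scalerA mulVf ?fact_neq0 // scale1r.
  by congr (_ - _ *: _); apply: eq_bigr => s _; rewrite prod_mktuple.
apply/spanZ/span_sum => s _; apply: (word_perm hG) => //.
by rewrite perm_sym; apply/(@tuple_permP _ _ _ (in_tuple w)); exists s.
Qed.

Section CoefficientRing.
Variable R : A -> Prop.
Hypothesis RM : forall r s, R r -> R s -> R (r * s).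
Hypothesis Rcomm : forall i r, R r -> R (h i * r - r * h i).
Hypothesis hcomm : forall i k, exists c : 'I_q -> A,
  (forall m, R (c m)) /\ h i * h k - h k * h i = \sum_m c m * h m.

Let short n a := exists r w, [/\ R r, (0 < size w <= n)%N & a = r * word w].

Let short_h n i a : span (short n) a -> span (short n.+1) (h i * a).
Proof.
apply: span_mull => {}a [r [w [Rr /andP[w0 wn] ->]]].
have -> : h i * (r * word w) = r * word (i :: w) + (h i * r - r * h i) * word w.
  by rewrite big_cons mulrBl !mulrA addrCA subrr addr0.
apply: spanD; apply: span_gen; first by exists r, (i :: w); rewrite /= ltnS wn.
by exists (h i * r - r * h i), w; split=> //; [exact: Rcomm | rewrite w0 ltnW].
Qed.

Let short_word n v a : span (short n) a -> span (short (size v + n)) (word v * a).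
Proof.
move=> sa; elim: v => [|i v IH]; first by rewrite big_nil mul1r.
by rewrite big_cons -mulrA addSn; apply: short_h.
Qed.

Let short_mul n r a : R r -> span (short n) a -> span (short n) (r * a).
Proof.
move=> Rr; apply: span_mull => {}a [s [w [Rs wn ->]]].
by apply: span_gen; exists (r * s), w; rewrite mulrA; split=> //; apply: RM.
Qed.

(** Exchanging two factors in a word costs a combination of shorter words, as
    coefficients can be moved to the left past the generators; so a word is
    its symmetrization up to shorter words. The commutators are combinations of
    the generators without constant term, so the shorter words are nonempty. *)
Lemma word_reorder r w : R r -> w != [::] ->
  span (fun a => exists s v, [/\ R s, v != [::] & a = s * symmon h v]) (r * word w).
Proof.
set G := fun _ => _.
suff H n a : span (short n) a -> span G a.
  move=> Rr; rewrite -size_eq0 -lt0n => w0; apply: (H (size w)); apply: span_gen.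
  by exists r, w; rewrite w0 leqnn.
elim: n a => [|n IH] a; apply: span_sub => {}a [s [v [Rs /andP[v0 vn] ->]]].
  by rewrite leqNgt v0 in vn.
rewrite -[word v](subrK (symmon h v)) mulrDr; apply: spanD; last first.
  by apply: span_gen; exists s, v; rewrite -size_eq0 -lt0n.
apply/IH/short_mul => //; apply: word_symmon => w1 w2 i k sz.
have [c [Rc ->]] := hcomm i k.
rewrite mulr_sumr mulr_suml; apply: span_sum => m _.
rewrite -!mulrA -[h m * _](big_cons _ _ m w2 xpredT) /=.
have : span (short (size w2).+1) (c m * word (m :: w2)).
  by apply: span_gen; exists (c m), (m :: w2); split=> /=.
move/(short_word w1); apply: span_sub => {}a [r' [u [Rr' /andP[u0 un] ->]]].
apply: span_gen; exists r', u; rewrite u0; split=> //.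
by rewrite -ltnS (leq_trans _ vn) // -sz ltnS -addnS.
Qed.

End CoefficientRing.
End Words.

(** * Formal power series *)

Section PowerSeriesRing.
Variables (K : fieldType) (p : nat).
Implicit Types f g : psr K p.

Lemma psmulC f g : psmul f g = psmul g f.
Proof.
apply/funext => a; rewrite /psmul; set n := (\sum_i a i)%N.
have an i : (a i <= n)%N by rewrite /n (bigD1 i) //= leq_addr.
pose cmp (b : {ffun 'I_p -> 'I_n.+1}) : {ffun 'I_p -> 'I_n.+1} :=
  [ffun i => inord (a i - b i)].
have cmpE b i : cmp b i = (a i - b i)%N :> nat.
  by rewrite ffunE inordK // ltnS (leq_trans (leq_subr _ _)).
have cmpK (b : {ffun 'I_p -> 'I_n.+1}) : [forall i, b i <= a i]%N -> cmp (cmp b) = b.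
  by move=> /forallP hb; apply/ffunP => i; apply: val_inj; rewrite /= !cmpE subKn.
rewrite (reindex_onto cmp cmp) => [|b /cmpK //]; apply: eq_big => [b|b /andP[_ /eqP bb]].
  apply/andP/idP => [[_ /eqP <-]|hb]; first by apply/forallP => i; rewrite cmpE leq_subr.
  by rewrite cmpK // eqxx; split=> //; apply/forallP => i; rewrite cmpE leq_subr.
have ba i : (b i <= a i)%N by rewrite -bb cmpE leq_subr.
by rewrite mulrC; congr (g _ * f _); apply/ffunP => i; rewrite [LHS]ffunE [RHS]ffunE cmpE ?subKn.
Qed.

Lemma psmulX mu g a :
  psmul (@psX K p mu) g a = if (0 < a mu)%N then g [ffun i => a i - (i == mu)]%N else 0.
Proof.
rewrite /psmul; set n := (\sum_i a i)%N.
pose b0 : {ffun 'I_p -> 'I_n.+1} := [ffun i => inord (i == mu)].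
have Xb (b : {ffun 'I_p -> 'I_n.+1}) i :
    psX K mu [ffun i => b i : nat] != 0 -> b i = (i == mu) :> nat.
  rewrite /psX; case: ([ffun i => b i : nat] =P midx mu)
    => [/(congr1 (fun F : {ffun 'I_p -> nat} => F i))|]; last by rewrite eqxx.
  by rewrite !ffunE.
case: ifPn => [amu|]; last first.
  rewrite -leqNgt leqn0 => /eqP amu; apply: big1 => b /forallP/(_ mu).
  rewrite amu leqn0 => /eqP b0mu.
  have [->|/(Xb b mu)] := eqVneq (psX K mu [ffun i => b i : nat]) 0; first by rewrite mul0r.
  by rewrite b0mu eqxx.
have n0 : (0 < n)%N by rewrite /n (bigD1 mu) //= addn_gt0 amu.
have b0E i : b0 i = (i == mu) :> nat.
  by rewrite ffunE inordK // ltnS; case: (i == mu).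
rewrite (bigD1 b0) /=; last first.
  by apply/forallP => i; rewrite b0E; case: eqP => [->|].
rewrite big1 ?addr0 => [|b /andP[_ /eqP bb0]].
  rewrite /psX; have -> : [ffun i => b0 i : nat] = midx mu.
    by apply/ffunP => i; rewrite [LHS]ffunE [RHS]ffunE b0E.
  by rewrite eqxx mul1r; congr g; apply/ffunP => i; rewrite [LHS]ffunE [RHS]ffunE b0E.
have [->|hb] := eqVneq (psX K mu [ffun i => b i : nat]) 0; first by rewrite mul0r.
by case: bb0; apply/ffunP => i; apply: val_inj; rewrite /= b0E (Xb b i).
Qed.

Hypothesis char0 : forall n, n.+1%:R != 0 :> K.

(** Dividing the coefficient of a nonconstant monomial among its variables in
    proportion to their exponents gives a canonical choice of the g mu. *)
Lemma ps_decomp f : exists g : 'I_p -> psr K p,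
  f = f [ffun=> 0%N] *: @ps1 K p + \sum_mu psmul (@psX K p mu) (g mu).
Proof.
pose g mu : psr K p := fun b : {ffun 'I_p -> nat} =>
  ((b mu).+1%:R / (\sum_i b i).+1%:R : K) *: f [ffun i => b i + (i == mu)]%N.
exists g; apply/funext => a; rewrite fct_sumE.
rewrite -[RHS]/(f [ffun=> 0%N] * (a == [ffun=> 0%N])%:R
  + \sum_mu psmul (@psX K p mu) (g mu) a).
under eq_bigr => mu _ do rewrite psmulX.
have [a0|an0] := eqVneq a [ffun=> 0%N].
  by rewrite a0 mulr1 big1 ?addr0 // => mu _; rewrite ffunE.
rewrite mulr0 add0r; set s := (\sum_i a i)%N.
have s0 : s%:R != 0 :> K.
  suff: (0 < s)%N by case: s => // s _; apply: char0.
  rewrite lt0n sum_nat_eq0; apply: contra an0 => /forallP h.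
  by apply/eqP/ffunP => i; rewrite ffunE; apply/eqP/h.
rewrite (eq_bigr (fun mu => (a mu)%:R * (s%:R^-1 * f a))) => [|mu _].
  by rewrite -mulr_suml -natr_sum mulrA divff // mul1r.
case: ifPn => [amu|]; last by rewrite -leqNgt leqn0 => /eqP->; rewrite mul0r.
rewrite /g; set b := [ffun i => _].
have ab i : a i = (b i + (i == mu))%N.
  by rewrite ffunE subnK //; case: eqP => [->|].
have -> : [ffun i => (b i + (i == mu))%N] = a by apply/ffunP => i; rewrite ffunE -ab.
have -> : (b mu).+1 = a mu by rewrite ab eqxx addn1.
have one : (\sum_(i < p) (i == mu))%N = 1%N.
  by rewrite (bigD1 mu) //= eqxx big1 // => i /negbTE->.
have -> : (\sum_i b i).+1 = s by rewrite /s (eq_bigr _ (fun i _ => ab i)) big_split /= one addn1.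
by rewrite mulrA.
Qed.
End PowerSeriesRing.

(** * Adic topologies and completed tensor products *)

Section AdicFacts.
Variables (K : fieldType) (A : algType K) (I : Type) (x : I -> A).
Implicit Types f g : cdual x.

Lemma adicZ n c a : adic x n a -> adic x n (c *: a).
Proof. by move=> h; rewrite -mulr_algl; apply: adicMl. Qed.

Lemma adicB n a b : adic x n a -> adic x n b -> adic x n (a - b).
Proof. by move=> ha hb; apply: adicD => //; rewrite -scaleN1r; apply: adicZ. Qed.

Lemma adic_sum n (J : Type) (r : seq J) (P : pred J) (F : J -> A) :
  (forall j, P j -> adic x n (F j)) -> adic x n (\sum_(j <- r | P j) F j).
Proof. by move=> h; apply: big_ind => //; [exact: adic0 | exact: adicD]. Qed.

Lemma adic_word n (w : seq I) b : adic x n b -> adic x (size w + n) ((\prod_(i <- w) x i) * b).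
Proof.
elim: w => [|i w IH] hb; first by rewrite big_nil mul1r.
by rewrite big_cons addSn -mulrA -[x i]mul1r; apply/adic_gen/IH.
Qed.

Lemma adicM m n a b : adic x m a -> adic x n b -> adic x (m + n) (a * b).
Proof.
move=> ha hb; elim: ha => {m a} [a|m a i c _ IH|m|m a c _ ha _ hc].
- exact: adicMl.
- by rewrite -mulrA addSn; apply: adic_gen.
- by rewrite mul0r; exact: adic0.
- by rewrite mulrDl; apply: adicD.
Qed.

Lemma cfunB f a b : f (a - b) = f a - f b.
Proof. by rewrite -scaleN1r cfunD cfunZ mulN1r. Qed.

Lemma cfun_span_eq0 f (G : A -> Prop) a : (forall b, G b -> f b = 0) -> span G a -> f a = 0.
Proof.
move=> h; elim=> [|c b v hb _ IH]; first exact: cfun0.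
by rewrite cfunD cfunZ h // IH mulr0 addr0.
Qed.

Lemma cfun_adic n f a b : kills x n f -> adic x n (a - b) -> f a = f b.
Proof. by move=> hf /hf/eqP; rewrite cfunB subr_eq0 => /eqP. Qed.

End AdicFacts.

Section TensorFacts.
Variables (K : fieldType) (A B : algType K) (I J : Type) (x : I -> A) (y : J -> B).
Implicit Types (f : cdual x) (g : cdual y) (t u z : ctens x y).

Lemma ctens_sumE (H : Type) (r : seq H) (P : pred H) (F : H -> ctens x y) f g :
  (\sum_(j <- r | P j) F j : ctens x y) f g = \sum_(j <- r | P j) F j f g.
Proof. by apply: (big_morph (fun t : ctens x y => t f g)). Qed.

Lemma ctens0l t g : t 0 g = 0.
Proof. by rewrite -(scale0r (0 : cdual x)) ctensZl mul0r. Qed.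

Lemma ctens0r t f : t f 0 = 0.
Proof. by rewrite -(scale0r (0 : cdual y)) ctensZr mul0r. Qed.

Lemma ctens_mulL n t u s f g : approx n t s -> kills x n f -> kills y n g ->
  (t * u) f g = \sum_(p <- s) u (cdual_lmul f p.1) (cdual_lmul g p.2).
Proof.
move=> hs hf hg; have [r hr] := cvalP u n.
by rewrite [LHS](approxM hs hr) // (prod_seq_valR _ hr).
Qed.

Lemma ctens_mulR n t u r f g : approx n u r -> kills x n f -> kills y n g ->
  (t * u) f g = \sum_(p <- r) t (cdual_rmul f p.1) (cdual_rmul g p.2).
Proof.
move=> hr hf hg; have [s hs] := cvalP t n.
by rewrite [LHS](approxM hs hr) // (prod_seq_valL _ hs).
Qed.

Lemma ptensor_mulL a b u f g :
  ((a ⊗[x, y] b) * u) f g = u (cdual_lmul f a) (cdual_lmul g b).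
Proof.
have [n [hf hg]] := level f g.
by rewrite (ctens_mulL _ (@approx_ptensor _ _ _ _ _ x y n a b) hf hg) big_seq1.
Qed.

Lemma ptensor_mulR a b t f g :
  (t * (a ⊗[x, y] b)) f g = t (cdual_rmul f a) (cdual_rmul g b).
Proof.
have [n [hf hg]] := level f g.
by rewrite (ctens_mulR _ (@approx_ptensor _ _ _ _ _ x y n a b) hf hg) big_seq1.
Qed.

Lemma ptensorM a b c d :
  (a ⊗[x, y] b) * (c ⊗[x, y] d) = (a * c) ⊗[x, y] (b * d).
Proof. by apply: ctens_ext => f g; rewrite ptensor_mulL. Qed.

Lemma ptensor_expr_sum (T : finType) (a : T -> A) (b : T -> B) m :
  (\sum_i a i ⊗[x, y] b i) ^+ m =
  \sum_(w : m.-tuple T) (\prod_(i <- w) a i) ⊗[x, y] (\prod_(i <- w) b i).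
Proof.
rewrite expr_sum_tuple; apply: eq_bigr => w _.
by elim: (tval w) => [|i v IH]; rewrite ?big_nil // !big_cons IH ptensorM.
Qed.

Lemma ctens_suml (T : Type) (r : seq T) (c : T -> K) (F : T -> cdual x) (t : ctens x y) g :
  t (\sum_(j <- r) c j *: F j) g = \sum_(j <- r) c j * t (F j) g.
Proof.
elim: r => [|j r IH]; first by rewrite !big_nil ctens0l.
by rewrite !big_cons ctensDl ctensZl IH.
Qed.

Lemma ctens_sumr (T : Type) (r : seq T) (c : T -> K) (F : T -> cdual y) (t : ctens x y) f :
  t f (\sum_(j <- r) c j *: F j) = \sum_(j <- r) c j * t f (F j).
Proof.
elim: r => [|j r IH]; first by rewrite !big_nil ctens0r.
by rewrite !big_cons ctensDr ctensZr IH.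
Qed.
Section Exponential.
Variable z : ctens x y.
Hypothesis z_null : forall n m, (n <= m)%N -> tnull n (z ^+ m).

Let part n : ctens x y := \sum_(k < n) (k`!)%:R^-1 *: z ^+ k.

Let part_stable n m f g : (n <= m)%N -> kills x n f -> kills y n g ->
  part m f g = part n f g.
Proof.
move=> /subnK <- hf hg; elim: (m - n)%N => [//|k IH].
by rewrite addSn /part big_ord_recr /= IH (z_null (leq_addl k n)) // mulr0 addr0.
Qed.

Let lim_val f g := part (sval (cid (level f g))) f g.

Let lim_valE n f g : kills x n f -> kills y n g -> lim_val f g = part n f g.
Proof.
move=> hf hg; rewrite /lim_val; case: cid => m [hf' hg'] /=.
by rewrite -(part_stable (leq_maxl m n)) // (part_stable (leq_maxr m n)).
Qed.

Let lim : ctens x y.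
Proof.
exists lim_val => n; have [s hs] := cvalP (part n) n; exists s => f g hf hg.
by rewrite (lim_valE hf hg) hs.
Defined.

(** The terms of index at least n vanish on functionals that kill the n-th
    powers of the ideals, so the series becomes a finite sum there. *)
Lemma cexpE n f g : kills x n f -> kills y n g ->
  cexp z f g = \sum_(k < n) (k`!)%:R^-1 * (z ^+ k) f g.
Proof.
have : sums_to (@tnull _ _ _ _ _ x y) (fun n => (n`!)%:R^-1 *: z ^+ n) (cexp z).
  apply: (@xgetPex _ 0 [set e | sums_to _ _ e]%classic).
  exists lim => m; exists m => M mM f' g' hf hg /=.
  rewrite -/(part M) (lim_valE hf hg) (part_stable mM) //.
  by rewrite mulN1r subrr.
move=> /(_ n) [N hN] hf hg.
have /eqP := hN (maxn N n) (leq_maxl _ _) f g hf hg.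
rewrite -/(part _) /= mulN1r subr_eq0 => /eqP->.
by rewrite (part_stable (leq_maxr N n)) // /part ctens_sumE.
Qed.

End Exponential.
End TensorFacts.

Section ExponentialProduct.
Variables (K : fieldType) (A B : algType K) (I J : Type) (x : I -> A) (y : J -> B).
Variables (S T : finType) (a : S -> A) (b : S -> B) (c : T -> A) (d : T -> B).
Local Notation z1 := (\sum_i a i ⊗[x, y] b i).
Local Notation z2 := (\sum_i c i ⊗[x, y] d i).
Hypothesis z1_null : forall n m, (n <= m)%N -> tnull n (z1 ^+ m).
Hypothesis z2_null : forall n m, (n <= m)%N -> tnull n (z2 ^+ m).

(** Finitely many terms of the two exponential series survive at each level. *)
Lemma cexp_mulE n1 n2 (f : cdual x) (g : cdual y) :
  kills x n1 f -> kills y n1 g -> kills x n2 f -> kills y n2 g ->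
  (cexp z1 * cexp z2) f g = \sum_(k < n1) \sum_(l < n2)
    \sum_(w : k.-tuple S) \sum_(w' : l.-tuple T) (k`! * l`!)%:R^-1 *
      f ((\prod_(i <- w) a i) * \prod_(i <- w') c i) *
      g ((\prod_(i <- w) b i) * \prod_(i <- w') d i).
Proof.
move=> hf1 hg1 hf2 hg2; have [r hr] := cvalP (cexp z2) n1.
rewrite (ctens_mulR _ hr) //.
under eq_bigr => q _ do rewrite (cexpE z1_null (kills_rmul _ hf1) (kills_rmul _ hg1)).
rewrite exchange_big; apply: eq_bigr => k _ /=; rewrite -mulr_sumr.
rewrite -(ctens_mulR (z1 ^+ k) hr) // ptensor_expr_sum mulr_suml ctens_sumE mulr_sumr.
rewrite [RHS]exchange_big; apply: eq_bigr => w _.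
rewrite ptensor_mulL (cexpE z2_null (kills_lmul _ hf2) (kills_lmul _ hg2)) mulr_sumr.
apply: eq_bigr => l _; rewrite ptensor_expr_sum ctens_sumE !mulr_sumr.
by apply: eq_bigr => w' _ /=; rewrite natrM invfM !mulrA.
Qed.

End ExponentialProduct.

(** * Antisymmetry of the structure constants of the cobracket *)

Section Antisymmetry.
Variables (K : fieldType) (L : vectType K) (B : objB L) (e : adapted_basis B).

Lemma ptensor2E (a b : L) (xi : 'Hom(L, K^o)) : ptensor2 a b xi = xi a *: b.
Proof.
have lin : linear (fun xi : 'Hom(L, K^o) => xi a *: b).
  by move=> c f g; rewrite add_lfunE scale_lfunE scalerDl scalerA.
pose F : {linear 'Hom(L, K^o) -> L} := HB.pack (fun xi : 'Hom(L, K^o) => xi a *: b)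
  (GRing.isLinear.Build K 'Hom(L, K^o) L *:%R _ lin).
exact: (lfunE F).
Qed.

Lemma dual_bracketE (D : 'Hom(L, tensor2 L)) (xi th : 'Hom(L, K^o)) a :
  dual_bracket D xi th a = th (D a xi).
Proof.
have lin : linear (fun a => th (D a xi) : K^o).
  by move=> c u v; rewrite linearP add_lfunE scale_lfunE linearP.
pose F : {linear L -> K^o} := HB.pack (fun a => th (D a xi) : K^o)
  (GRing.isLinear.Build K L K^o *:%R _ lin).
exact: (lfunE F).
Qed.

(** The bracket dual to the cobracket is alternating; its value on the dual
    basis of X reads off the structure constants. *)
Lemma strg_antisym rho sig mu : @strg _ _ _ e rho sig mu = - @strg _ _ _ e sig rho mu.
Proof.
pose F (xi th : 'Hom(L, K^o)) : K := th (cobracket B (tnth (basV e) mu) xi).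
have FF xi : F xi xi = 0.
  by rewrite /F -dual_bracketE cobracketxx lfunE.
have anti xi th : F xi th = - F th xi.
  apply/eqP; rewrite -addr_eq0; apply/eqP.
  have := FF (xi + th); rewrite /F linearD !add_lfunE !linearD /= -!/(F _ _).
  by rewrite !FF add0r addr0 addrC.
pose x i : 'Hom(L, K^o) := linfun (coord (basV e) i : L -> K^o).
have xE i j : x i (tnth (basV e) j) = (i == j)%:R :> K.
  by rewrite /x lfunE /= (tnth_nth 0) coord_free ?(basis_free (basVP e)) // eq_sym.
have FE r s : F (x r) (x s) = @strg _ _ _ e r s mu.
  rewrite /F strgE sum_lfunE linear_sum (bigD1 r) //= [X in _ + X]big1 => [|r' rr'].
    rewrite addr0 sum_lfunE linear_sum (bigD1 s) //= [X in _ + X]big1 => [|s' ss'].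
      by rewrite addr0 scale_lfunE ptensor2E !linearZ /= !xE !eqxx scale1r; exact: mulr1.
    rewrite scale_lfunE ptensor2E !linearZ /= !xE [s == _]eq_sym (negbTE ss').
    by rewrite !scaler0.
  rewrite sum_lfunE linear_sum big1 // => s' _.
  by rewrite scale_lfunE ptensor2E !linearZ /= !xE [r == _]eq_sym (negbTE rr') scale0r !scaler0.
by rewrite -!FE anti.
Qed.

End Antisymmetry.

(** * Dense subspaces of the quantized algebra *)

Section Quantization.
Variables (K : fieldType) (L : vectType K) (B : objB L) (e : adapted_basis B).
Variable U : quantization e.
Hypothesis char0 : forall n, n.+1%:R != 0 :> K.
Local Notation X := (qX U).
Local Notation H := (qH U).
Local Notation Xw v := (\prod_(mu <- v) qX U mu).
Local Notation Hw w := (\prod_(i <- w) qH U i).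
Local Notation hX t m := (lcomb (qH U) t ^+ m).
Local Notation adicX := (adic (qX U)).
Local Notation eps := (counit (qhopf U)).
Local Notation Delta := (qhopf U).
Local Notation gam := (@strg _ _ _ e).
Implicit Types N Z : cdual X.

Lemma qpsC f g : qps U f * qps U g = qps U g * qps U f.
Proof. by rewrite -!qpsM psmulC. Qed.

Lemma qps_decomp f : exists g : 'I_(dimV e) -> psr K (dimV e),
  qps U f = (f [ffun=> 0%N])%:A + \sum_mu X mu * qps U (g mu).
Proof.
have [g E] := ps_decomp char0 f; exists g.
rewrite {1}E linearD linearZ /= qps1 linear_sum /=; congr (_ + _).
by apply: eq_bigr => mu _; rewrite qpsM.
Qed.

Lemma qpsXC f mu : qps U f * X mu = X mu * qps U f.
Proof. exact: qpsC. Qed.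

(** Membership in the closure of the span, one power of the ideal at a time. *)
Definition approx_span (G : U -> Prop) n a := exists2 b, span G b & adicX n (a - b).

Lemma approx_spanD G n a b :
  approx_span G n a -> approx_span G n b -> approx_span G n (a + b).
Proof.
move=> [p hp ha] [q hq hb]; exists (p + q); first exact: spanD.
by rewrite opprD addrACA; apply: adicD.
Qed.

Lemma span_approx_span G n a : span G a -> approx_span G n a.
Proof. by move=> h; exists a; rewrite ?subrr //; exact: adic0. Qed.

Lemma approx_span_span (G G' : U -> Prop) n a :
  (forall g, G g -> approx_span G' n g) -> span G a -> approx_span G' n a.
Proof.
move=> h; elim=> [|c g v hg _ IH]; first exact/span_approx_span/span_nil.
apply: approx_spanD => //; have [p hp hn] := h g hg.
by exists (c *: p); rewrite -?scalerBr; [apply: spanZ | apply: adicZ].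
Qed.

Lemma qps_approx n f : approx_span (fun a => exists v, a = Xw v) n (qps U f).
Proof.
elim: n f => [|n IH] f; first by exists 0; [exact: span_nil | exact: adic_all].
have [g ->] := qps_decomp f; apply: approx_spanD.
  by apply/span_approx_span/spanZ/span_gen; exists [::]; rewrite big_nil.
apply: big_ind => [||mu _]; [exact/span_approx_span/span_nil | exact: approx_spanD |].
have [p hp hg] := IH (g mu); exists (X mu * p).
  by apply: span_mull hp => _ [v ->]; apply: span_gen; exists (mu :: v); rewrite big_cons.
by rewrite -mulrBr -[X mu]mul1r; apply: adic_gen.
Qed.

Lemma counit_adic1 : kills X 1 eps.
Proof.
move=> a; move E : 1%N => n h; elim: h E => {n a} //.
- by move=> n a mu c _ _ _; rewrite !counitM (@qcounitX _ _ _ _ U) mulr0 mul0r.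
- by move=> *; exact: cfun0.
- by move=> n a b _ ha _ hb E; rewrite cfunD ha ?hb ?addr0.
Qed.

Lemma counit_qps f : eps (qps U f) = f [ffun=> 0%N].
Proof.
have [g ->] := qps_decomp f; rewrite cfunD cfunZ counit1 mulr1 cfun_sum.
by rewrite big1 ?addr0 // => mu _; rewrite counitM (@qcounitX _ _ _ _ U) mul0r.
Qed.

Lemma qps_adic1 f : adicX 1 (qps U f - (eps (qps U f))%:A).
Proof.
rewrite counit_qps; have [g ->] := qps_decomp f; rewrite addrC addKr.
by apply: adic_sum => mu _; rewrite -[X mu]mul1r; apply: adic_gen; exact: adic_all.
Qed.

(** The counit of the commutator [H_i, X^mu] is 0. So commuting H_i past X^mu
    stays in the right ideal generated by the X, the powers of which are thus
    two-sided ([adic_left_mull]). *)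
Lemma qA0 i mu : qA U i mu [ffun=> 0%N] = 0.
Proof.
rewrite -counit_qps -qHX cfunB !counitM (@qcounitX _ _ _ _ U) mulr0 mul0r subrr //.
Qed.

Lemma symmon_span w : span (fun a => exists v, a = Hw v) (symmon H w).
Proof.
apply/spanZ/span_sum => s _; apply: span_gen.
exists (mktuple (fun k => tnth (in_tuple w) (s k))).
by rewrite prod_mktuple.
Qed.

(** In the enveloping algebra the words are reordered into symmetrized ones,
    and these are what the symmetrization map is given on. *)
Lemma span_symmon (u : U) : span (fun a => exists f w, a = qps U f * symmon H w) u.
Proof.
have [_ hU _] := qtensor U; have [s ->] := hU u.
apply: span_sum => -[f u'] _ /=; apply: span_mull (_ : span (fun a => exists w, a = symmon H w) _).
  by move=> _ [w ->]; apply: span_gen; exists f, w.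
have [hC hgen _] := qenvP U; have [r ->] := hgen u'.
apply: (@span_map _ _ _ (qsym U) (fun a => exists w, a = symmon (@qenvH _ _ _ _ U) w)).
- exact: linearP.
- by move=> _ [w ->]; rewrite qsymE; apply: span_gen; exists w.
apply: span_sum => -[c w] _ /=.
have [->|w0] := eqVneq w [::].
  rewrite big_nil; apply/spanZ/span_gen; exists [::]; rewrite /symmon /= invr1 scale1r.
  rewrite (eq_bigr (fun=> 1)) => [|s0 _]; last by rewrite big_ord0.
  by rewrite sumr_const card_Sn.
rewrite -mulr_algl.
have := @word_reorder _ _ _ (@qenvH _ _ _ _ U) char0 (fun a => exists d : K, a = d%:A).
move=> /(_ _ _ _ (c%:A) w) Hw; apply: (span_sub _ (Hw _ _ _ _ w0)).
- by move=> _ [_ [v [[d ->] _ ->]]]; rewrite mulr_algl; apply/spanZ/span_gen; exists v.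
- by move=> _ _ [d ->] [d' ->]; exists (d * d'); rewrite -scalerAl mul1r scalerA.
- by move=> i _ [d ->]; exists 0; rewrite mulr_algl mulr_algr subrr scale0r.
- move=> i k; exists (fun m => (strC i k m)%:A); split; first by move=> m; exists (strC i k m).
  by rewrite hC; apply: eq_bigr => m _; rewrite mulr_algl.
- by exists c.
Qed.

(** The powers of the ideal (X) with the X collected on the left, where the
    action of the functionals is known. *)
Definition adic_left n : U -> Prop :=
  span (fun a => exists v b, size v = n /\ a = Xw v * b).

Lemma adic_left_mull n c a : adic_left n a -> adic_left n (c * a).
Proof.
pose G c := forall n a, adic_left n a -> adic_left n (c * a).
have GD a' b' : G a' -> G b' -> G (a' + b').
  by move=> ha hb m b hm; rewrite mulrDl; apply: spanD; [apply: ha | apply: hb].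
have GM a' b' : G a' -> G b' -> G (a' * b').
  by move=> ha hb m b hm; rewrite -mulrA; apply/ha/hb.
have GS mu m b : adic_left m b -> adic_left m.+1 (X mu * b).
  apply: span_mull => _ [v [c' [sv ->]]]; apply: span_gen.
  by exists (mu :: v), c'; rewrite /= sv big_cons mulrA.
have Gps f : G (qps U f).
  move=> m; elim: m => [|m IH] b.
    by move=> _; apply: span_gen; exists [::], (qps U f * b); rewrite big_nil mul1r.
  apply: span_mull => _ [v [c' [sv ->]]]; case: v sv => // mu v [sv].
  rewrite big_cons -mulrA mulrA qpsXC -mulrA; apply/GS/IH; apply: span_gen.
  by exists v, c'.
have GH i : G (H i).
  move=> m; elim: m => [|m IH] b.
    by move=> _; apply: span_gen; exists [::], (H i * b); rewrite big_nil mul1r.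
  apply: span_mull => _ [v [c' [sv ->]]]; case: v sv => // mu v [sv].
  rewrite big_cons -mulrA; set b' := _ * c'.
  have hb' : adic_left m b' by apply: span_gen; exists v, c'.
  rewrite mulrA -[H i * _](subrK (X mu * H i)) qHX mulrDl -[X mu * _ * _]mulrA.
  apply: spanD; last exact/GS/IH.
  have [g ->] := qps_decomp (qA U i mu); rewrite qA0 scale0r add0r mulr_suml.
  by apply: span_sum => nu _; rewrite -mulrA; apply/GS/Gps.
suff Gc : G c by exact: Gc.
have GZ d a' : G a' -> G (d *: a').
  by move=> h m b hb; rewrite -scalerAl; apply/spanZ/h.
have Gnil : G 0 by move=> m b _; rewrite mul0r; exact: span_nil.
have Gw w : G (Hw w).
  elim: w => [|i w IH]; last by rewrite big_cons; apply: GM.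
  by rewrite big_nil => m b; rewrite mul1r.
have Gspan G' b : (forall a', G' a' -> G a') -> span G' b -> G b.
  by move=> hG; elim=> // d a' v ha' _; apply/GD/GZ/hG.
apply: (Gspan _ _ _ (span_symmon c)) => _ [f [w ->]]; apply: GM => //.
by apply: (Gspan _ _ _ (symmon_span w)) => _ [v ->].
Qed.

Lemma adic_left_X n mu a : adic_left n a -> adic_left n.+1 (X mu * a).
Proof.
apply: span_mull => _ [v [b [sv ->]]]; apply: span_gen.
by exists (mu :: v), b; rewrite /= sv big_cons mulrA.
Qed.

Lemma adic_leftP n a : adicX n a -> adic_left n a.
Proof.
elim=> {n a} [a|n a mu c _ IH|n|n a b _ ha _ hb].
- by apply: span_gen; exists [::], a; rewrite big_nil mul1r.
- by rewrite -mulrA; apply/adic_left_mull/adic_left_X.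
- exact: span_nil.
- exact: spanD.
Qed.

Definition monomial n : U -> Prop :=
  fun a => exists v t m, (n <= size v)%N /\ a = Xw v * hX t m.

Lemma adic_monomials n k u : adicX n u -> approx_span (monomial n) k u.
Proof.
move/adic_leftP; apply: approx_span_span => _ [v [b [sv ->]]].
have vb a : adicX k a -> adicX k (Xw v * a) by move=> ha; apply: adicMl.
have [p hp hb] : approx_span (fun a => exists v' t m, a = Xw v' * hX t m) k b.
  apply: approx_span_span (span_symmon b) => _ [f [w ->]].
  have [p hp hf] := qps_approx k f; exists (p * symmon H w); last first.
    by rewrite -mulrBl; apply: adicMr.
  elim: hp => [|c _ p' [v' ->] _ IH]; first by rewrite mul0r; exact: span_nil.
  rewrite mulrDl; apply: spanD => //; rewrite -scalerAl; apply: spanZ.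
  apply: span_mull (symmon_powers H w) => _ [t ->].
  by apply: span_gen; exists v', t, (size w).
exists (Xw v * p); last by rewrite -mulrBr; apply: vb.
apply: span_mull hp => _ [v' [t [m ->]]]; apply: span_gen.
by exists (v ++ v'), t, m; rewrite size_cat sv leq_addr big_cat mulrA.
Qed.

(** The elements X^v h^n with h = sum t_i H_i span a dense subspace, so that
    identities between continuous functionals can be checked on them. All the
    formulas below are simple on these elements. *)
Lemma cdual_ext_monomials (f g : cdual X) :
  (forall v t m, f (Xw v * hX t m) = g (Xw v * hX t m)) -> f = g.
Proof.
move=> fg; apply: cdual_ext => u; have [k [hf hg]] := level f g.
have [p hp hu] : approx_span (monomial 0) k u by apply: adic_monomials; exact: adic_all.
rewrite (cfun_adic hf hu) (cfun_adic hg hu).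
elim: hp => [|c _ v [v' [t [m [_ ->]]]] _ IH]; first by rewrite !cfun0.
by rewrite !cfunD !cfunZ IH fg.
Qed.

(** * The filtration by the number of factors H *)

Lemma comulD a b : qhopf U (a + b) = qhopf U a + qhopf U b.
Proof. by have := comul_linear (qhopf U) 1 a b; rewrite !scale1r. Qed.

Lemma comulZ c a : qhopf U (c *: a) = c *: qhopf U a.
Proof.
have := comul_linear (qhopf U) c a 0; rewrite addr0 => ->.
by have := comul_linear (qhopf U) (-1) 0 0; rewrite scaler0 addr0 scaleN1r addNr => ->;
  rewrite addr0.
Qed.

(** At most m factors H. Membership is generated by left multiplications, so
    that the coproduct can be followed one factor at a time. *)
Inductive degH : nat -> U -> Prop :=
| degH_one m : degH m 1
| degH_ps m f u : degH m u -> degH m (qps U f * u)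
| degH_H m i u : degH m u -> degH m.+1 (H i * u)
| degH_add m u v : degH m u -> degH m v -> degH m (u + v).

Lemma qpsZ1 c : qps U (c *: @ps1 K _) = c%:A.
Proof. by rewrite linearZ /= qps1. Qed.

Lemma degHZ m c u : degH m u -> degH m (c *: u).
Proof. by rewrite -mulr_algl -qpsZ1; apply: degH_ps. Qed.

Lemma degH_zero m : degH m 0.
Proof. by rewrite -(scale0r 1); apply/degHZ/degH_one. Qed.

Lemma degHS m u : degH m u -> degH m.+1 u.
Proof.
by elim=> {m u} *; [exact: degH_one | exact: degH_ps | exact: degH_H | exact: degH_add].
Qed.

Lemma degHW m n u : (m <= n)%N -> degH m u -> degH n u.
Proof. by move=> /subnK <-; elim: (n - m)%N => // k IH /IH; exact: degHS. Qed.

Lemma degHM m n u v : degH m u -> degH n v -> degH (m + n) (u * v).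
Proof.
move=> hu hv; elim: hu => {m u} [m|m f u _|m i u _|m u w _ hu _ hw].
- by rewrite mul1r; apply: degHW hv; apply: leq_addl.
- by rewrite -mulrA; apply: degH_ps.
- by rewrite -mulrA addSn; apply: degH_H.
- by rewrite mulrDl; apply: degH_add.
Qed.

Lemma degH_sum m (J : Type) (r : seq J) (F : J -> U) :
  (forall j, degH m (F j)) -> degH m (\sum_(j <- r) F j).
Proof. by move=> h; apply: big_ind => //; [exact: degH_zero | exact: degH_add]. Qed.

Lemma degH_qps f : degH 0 (qps U f).
Proof. by rewrite -[qps U f]mulr1; apply/degH_ps/degH_one. Qed.

Lemma degH_gen i : degH 1 (H i).
Proof. by rewrite -[H i]mulr1; apply/degH_H/degH_one. Qed.

Lemma degH_Xw v : degH 0 (Xw v).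
Proof.
elim: v => [|mu v IH]; first by rewrite big_nil; exact: degH_one.
by rewrite big_cons; apply: degH_ps.
Qed.

Lemma degH_Hw w : degH (size w) (Hw w).
Proof.
elim: w => [|i w IH]; first by rewrite big_nil; exact: degH_one.
by rewrite big_cons; apply: degH_H.
Qed.

Lemma degH_symmon w : degH (size w) (symmon H w).
Proof.
apply: degHZ; apply: degH_sum => s.
rewrite -[X in degH X](size_tuple (mktuple (fun k => tnth (in_tuple w) (s k)))).
by rewrite -prod_mktuple; apply: degH_Hw.
Qed.

Lemma degH0P u : degH 0 u -> exists f, u = qps U f.
Proof.
move: {2}0%N (erefl 0%N) => z; move E : 0%N => n zn h; elim: h E {z zn} => {n u} //.
- by exists (@ps1 K _); rewrite qps1.
- by move=> n f u _ IH /IH[g ->]; exists (psmul f g); rewrite qpsM.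
- move=> n u v _ hu _ hv E; have [[f ->] [g ->]] := (hu E, hv E).
  by exists (f + g); rewrite linearD.
Qed.

Lemma degH_exists u : exists m, degH m u.
Proof.
elim: (span_symmon u) => [|c _ v [f [w ->]] _ [m hm]].
  by exists 0%N; exact: degH_zero.
exists (size w + m)%N; apply: degH_add; last by apply: degHW hm; apply: leq_addl.
by apply/degHZ/degH_ps/(degHW (leq_addr _ _))/degH_symmon.
Qed.

(** Elements of total degree m in the completed tensor square: at each level
    they are approximated by finite sums of such tensors. *)
Definition tensor_degH m (t : ctens X X) := forall n, exists s, approx n t s /\
  forall p, p \in s -> exists i j, [/\ (i + j)%N = m, degH i p.1 & degH j p.2].

Lemma tensor_degH_ptensor i j a b : degH i a -> degH j b -> tensor_degH (i + j) (a ⊗[X, X] b).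
Proof.
move=> ha hb n; exists [:: (a, b)]; split; first exact: approx_ptensor.
by move=> p; rewrite inE => /eqP->; exists i, j.
Qed.

Lemma tensor_degH_add m t u : tensor_degH m t -> tensor_degH m u -> tensor_degH m (t + u).
Proof.
move=> ht hu n; have [s [hs1 hs2]] := ht n; have [r [hr1 hr2]] := hu n.
exists (s ++ r); split; first exact: approx_add.
by move=> p; rewrite mem_cat => /orP[/hs2|/hr2].
Qed.

Lemma tensor_degH_scale m c t : tensor_degH m t -> tensor_degH m (c *: t).
Proof.
move=> ht n; have [s [hs1 hs2]] := ht n.
exists [seq (c *: p.1, p.2) | p <- s]; split => [f g hf hg|_ /mapP[p ps ->]].
  by rewrite big_map /= hs1 // mulr_sumr; apply: eq_bigr => p _; rewrite cfunZ mulrA.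
by have [i [j [ij hi hj]]] := hs2 p ps; exists i, j; split=> //; apply: degHZ.
Qed.

Lemma tensor_degH_zero m : tensor_degH m 0.
Proof. by move=> n; exists [::]; split=> // f g _ _; rewrite big_nil. Qed.

Lemma tensor_degH_sum m (J : Type) (r : seq J) (P : pred J) (F : J -> ctens X X) :
  (forall j, P j -> tensor_degH m (F j)) -> tensor_degH m (\sum_(j <- r | P j) F j).
Proof. by move=> h; apply: big_ind => //; [exact: tensor_degH_zero | exact: tensor_degH_add]. Qed.

Lemma tensor_degH_mul m m' t u : tensor_degH m t -> tensor_degH m' u ->
  tensor_degH (m + m') (t * u).
Proof.
move=> ht hu n; have [s [hs1 hs2]] := ht n; have [r [hr1 hr2]] := hu n.
exists (prod_seq s r); split; first exact: approxM.
move=> _ /allpairsP[[p q] /= [ps qr ->]] /=.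
have [i [j [ij hi hj]]] := hs2 p ps; have [i' [j' [ij' hi' hj']]] := hr2 q qr.
by exists (i + i')%N, (j + j')%N; split; [rewrite addnACA ij ij' | exact: degHM | exact: degHM].
Qed.

Lemma tensor_degH_lim m t :
  (forall n, exists2 u, tensor_degH m u & tnull n (t - u)) -> tensor_degH m t.
Proof.
move=> h n; have [u hu htu] := h n; have [s [hs1 hs2]] := hu n; exists s; split=> //.
move=> f g hf hg; rewrite -hs1 //; have /eqP := htu f g hf hg.
by rewrite /= mulN1r subr_eq0 => /eqP.
Qed.

(** A word in the two families X (x) 1 and 1 (x) X is indexed by a sequence of
    booleans, for inductions on the nested brackets of such words. *)
Definition ch_leaf (b : bool) (nu : 'I_(dimV e)) : ctens X X :=
  if b then X nu ⊗[X, X] 1 else 1 ⊗[X, X] X nu.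

Lemma ch_leaves k (rs : 'I_k -> nat * nat) (l : seq 'I_k) : exists bs,
  flatten [seq nseq (rs i).1 (fun nu => X nu ⊗[X, X] 1) ++
               nseq (rs i).2 (fun nu => 1 ⊗[X, X] X nu) | i <- l] = map ch_leaf bs.
Proof.
exists (flatten [seq nseq (rs i).1 true ++ nseq (rs i).2 false | i <- l]).
by rewrite map_flatten -map_comp; congr flatten; apply: eq_map => i /=; rewrite map_cat !map_nseq.
Qed.

(** A truncation t of the Campbell-Hausdorff series, with the induction
    principle that it is a linear combination of nested brackets. *)
Lemma comulX_lim n mu : exists2 t, tnull n (qhopf U (X mu) - t) &
  forall G : ctens X X -> Prop, G 0 -> (forall a b, G a -> G b -> G (a + b)) ->
    (forall c a, G a -> G (c *: a)) ->
    (forall bs, G (ch_nested (@strg _ _ _ e) (map ch_leaf bs) mu)) -> G t.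
Proof.
have [N hN] := @qcomulX _ _ _ _ U mu n; have := hN N (leqnn N).
set t := \sum_(k < N) _ => ht; exists t => // G G0 GD GZ Gch.
rewrite /t; apply: big_ind => // k _; rewrite /ch_term.
apply: big_ind => // j _; apply: big_ind => // rs _; apply: GZ.
have [bs ->] := ch_leaves (fun i => (nat_of_ord (rs i).1, nat_of_ord (rs i).2)) (enum 'I_j).
exact: Gch.
Qed.

Lemma tensor_degH_ch_leaf b nu : tensor_degH 0 (ch_leaf b nu).
Proof.
by case: b; apply: (@tensor_degH_ptensor 0 0); rewrite /= -?(qps1 U); exact: degH_qps.
Qed.

Lemma ch_nested_leaves b b' bs mu :
  ch_nested (@strg _ _ _ e) (map ch_leaf [:: b, b' & bs]) mu =
  \sum_rho \sum_sig @strg _ _ _ e rho sig mu *: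
    (ch_leaf b rho * ch_nested (@strg _ _ _ e) (map ch_leaf (b' :: bs)) sig).
Proof. by []. Qed.

Lemma tensor_degH_ch_nested bs mu : tensor_degH 0 (ch_nested (@strg _ _ _ e) (map ch_leaf bs) mu).
Proof.
elim: bs mu => [|b [|b' bs] IH] mu; [exact: tensor_degH_zero | exact: tensor_degH_ch_leaf |].
rewrite ch_nested_leaves; apply: tensor_degH_sum => rho _; apply: tensor_degH_sum => sig _.
apply/tensor_degH_scale/(@tensor_degH_mul 0 0); first exact: tensor_degH_ch_leaf.
exact: IH.
Qed.

Lemma tensor_degH_comulX mu : tensor_degH 0 (Delta (X mu)).
Proof.
apply: tensor_degH_lim => n; have [t ht ht'] := comulX_lim n mu; exists t => //.
apply: ht'; [exact: tensor_degH_zero | exact: tensor_degH_add | |].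
  by move=> c a; exact: tensor_degH_scale.
by move=> bs; apply: tensor_degH_ch_nested.
Qed.

Lemma tensor_degH_comul_qps f : tensor_degH 0 (Delta (qps U f)).
Proof.
apply: tensor_degH_lim => n; have [m hm] := comul_cont (qhopf U) n.
have [p hp hf] := qps_approx m f; exists (Delta p); last first.
  by rewrite -(subrK p (qps U f)) comulD addrK; apply: hm.
elim: hp => [|c _ p' [v ->] _ IH].
  by rewrite -(scale0r 0) comulZ scale0r; exact: tensor_degH_zero.
rewrite comulD comulZ; apply: tensor_degH_add => //; apply: tensor_degH_scale.
elim: v => [|mu v IHv].
  by rewrite big_nil comul1; apply: (@tensor_degH_ptensor 0 0); exact: degH_one.
by rewrite big_cons comulM; apply: (@tensor_degH_mul 0 0) => //; exact: tensor_degH_comulX.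
Qed.

(** In degree 0 this says that the coproduct of a power series is a limit of
    tensors of power series. *)
Lemma tensor_degH_comul m u : degH m u -> tensor_degH m (Delta u).
Proof.
elim=> {m u} [m|m f u _ IH|m i u _ IH|m u v _ hu _ hv].
- rewrite comul1 -[m]addn0; apply: tensor_degH_ptensor; exact: degH_one.
- by rewrite comulM -[m]add0n; apply: tensor_degH_mul IH; exact: tensor_degH_comul_qps.
- rewrite comulM -add1n; apply: tensor_degH_mul IH; rewrite qcomulH; apply: tensor_degH_add.
    apply: tensor_degH_sum => k _; apply: (@tensor_degH_ptensor 0 1); first exact: degH_qps.
    exact: degH_gen.
  by apply: (@tensor_degH_ptensor 1 0); [exact: degH_gen | exact: degH_one].
- by rewrite comulD; apply: tensor_degH_add.
Qed.


(** * Convolution modulo the ideal (X) *)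

Lemma lmul_adic1 N a c : kills X 1 N -> adicX 1 (a - c%:A) -> cdual_lmul N a = c *: N.
Proof.
move=> hN ha; apply: cdual_ext => b /=.
by rewrite -cfunZ -mulr_algl; apply: (cfun_adic hN); rewrite -mulrBl; apply: adicMr.
Qed.

(** As N does not distinguish a power series from its constant term, it sees
    Delta (f) as (eps (x) id) (Delta (f)), which is f by counitality. *)
Lemma conv_ps N Z f b : kills X 1 N ->
  conv Delta N Z (qps U f * b) = conv Delta N (cdual_lmul Z (qps U f)) b.
Proof.
move=> hN /=; have [n [_ hZ]] := level eps Z.
have hNn := killsW (leq_addr n 1%N) hN; have hZn := killsW (leq_addl 1%N n) hZ.
have hen := killsW (leq_addr n 1%N) counit_adic1.
have [s [hs1 hs2]] := tensor_degH_comul_qps f (1 + n)%N.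
rewrite comulM (ctens_mulL _ hs1) //.
rewrite (eq_big_seq (fun p => eps p.1 * Delta b N (cdual_lmul Z p.2))) => [|p ps]; last first.
  have [[|i] [j [// _ /degH0P[g ->] _]]] := hs2 p ps.
  by rewrite (lmul_adic1 hN (qps_adic1 g)) ctensZl.
rewrite -ctens_sumr; congr (Delta b N _); apply: cdual_ext => c.
rewrite cdual_sumE /= -[Z _]/(cdual_rmul Z c (qps U f)) -(counitl (qhopf U)) hs1 //.
by apply: kills_rmul.
Qed.


(** * Functionals that kill the left ideal of the H *)

(** Vanishing on the left ideal generated by the H_i. Together with the power
    series, this ideal spans the algebra; the functionals that kill it are
    those on K[[X]]. *)
Definition killsUH (f : cdual X) := forall a i, f (a * H i) = 0.

(** Each term of Delta (H_i) has some H_k as one of its two factors. *)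
Lemma killsUH_conv f g : killsUH f -> killsUH g -> killsUH (conv Delta f g).
Proof.
move=> hf hg a i; rewrite /= comulM qcomulH mulrDr ctens_addE mulr_sumr ctens_sumE.
rewrite ptensor_mulR big1 => [|k _]; rewrite ?ptensor_mulR.
  rewrite (_ : cdual_rmul f _ = 0) ?ctens0l ?addr0 //.
  by apply: cdual_ext => b; rewrite /= hf.
rewrite (_ : cdual_rmul g _ = 0) ?ctens0r //.
by apply: cdual_ext => b; rewrite /= hg.
Qed.

Lemma killsUH_counit : killsUH eps.
Proof. by move=> a i; rewrite counitM (@qcounitH _ _ _ _ U) mulr0. Qed.

Lemma comm_H_Xw i v : exists f, H i * Xw v - Xw v * H i = qps U f.
Proof.
elim: v => [|mu v [f hf]].
  by exists 0; rewrite big_nil mulr1 mul1r subrr linear0.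
have [g hg] := degH0P (degH_Xw v).
exists (psmul (qA U i mu) g + psmul (psX K mu) f).
rewrite big_cons linearD /= !qpsM -hf -hg -qHX -/(qX U mu).
rewrite mulrBl mulrBr !mulrA addrA subrK //.
Qed.

(** An element a H_i is brought to the form of a sum of f (X) h^n with n > 0 by
    [word_reorder]. The coefficient ring consists of the power series plus a
    power of (X) that the functional kills: only polynomials in X can be
    commuted past H_i explicitly. *)
Lemma killsUH_monomials (f : cdual X) :
  (forall v t m, f (Xw v * hX t m.+1) = 0) -> killsUH f.
Proof.
move=> hf; have [n hn] := cfun_cont f.
pose R (a : U) := exists g, adicX n (a - qps U g).
have Rps g : R (qps U g) by exists g; rewrite subrr; exact: adic0.
have RM r s : R r -> R s -> R (r * s).
  move=> [g hg] [g' hg']; exists (psmul g g').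
  have -> : r * s - qps U (psmul g g') = (r - qps U g) * s + qps U g * (s - qps U g').
    by rewrite qpsM mulrBl mulrBr addrA subrK.
  by apply: adicD; [apply: adicMr | apply: adicMl].
have RD r s : R r -> R s -> R (r + s).
  move=> [g hg] [g' hg']; exists (g + g'); rewrite linearD /= opprD addrACA.
  exact: adicD.
have Rad r s : adicX n (r - s) -> R s -> R r.
  move=> h [g hg]; exists g; rewrite -(subrK s r) -addrA; exact: adicD.
have Rcomm i r : R r -> R (H i * r - r * H i).
  move=> [g hg]; have [p hp hgp] := qps_approx n g.
  have hrp : adicX n (r - p) by rewrite -(subrK (qps U g) r) -addrA; apply: adicD.
  apply: (Rad _ (H i * p - p * H i)).
    have -> : H i * r - r * H i - (H i * p - p * H i) = H i * (r - p) - (r - p) * H i.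
      by rewrite mulrBr mulrBl !opprB addrACA [RHS]addrACA; congr (_ + _); exact: addrC.
    by apply: adicB; [apply: adicMl | apply: adicMr].
  elim: hp => [|c _ q [v ->] _ IH].
    by exists 0; rewrite mulr0 mul0r linear0 !subr0; exact: adic0.
  rewrite mulrDr mulrDl opprD addrACA; apply: RD => //.
  have [f' hf'] := comm_H_Xw i v.
  by rewrite -scalerAr -scalerAl -scalerBr hf' -mulr_algl -qpsZ1; apply: RM.
have fw g w : w != [::] -> f (qps U g * Hw w) = 0.
  move=> w0; apply: cfun_span_eq0 (@word_reorder _ _ _ H char0 R RM Rcomm _ _ _ (Rps g) w0).
    move=> _ [s [v [[g' hs] v0 ->]]].
    have [p hp hg] := qps_approx n g'.
    have hsp : adicX n (s - p) by rewrite -(subrK (qps U g') s) -addrA; apply: adicD.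
    rewrite (@cfun_adic _ _ _ _ n f _ (p * symmon H v)) //; last first.
      by rewrite -mulrBl; apply: adicMr.
    rewrite -[f _]/(cdual_rmul f (symmon H v) p).
    apply: cfun_span_eq0 hp => _ [u ->] /=.
    rewrite -[f _]/(cdual_lmul f (Xw u) (symmon H v)).
    apply: cfun_span_eq0 (symmon_powers H v) => _ [t ->] /=.
    by case: v v0 => // j v _; apply: hf.
  move=> i k; exists (fun m => qps U (qC U i k m)); split=> [m|]; first exact: Rps.
  exact: qHH.
move=> a i; rewrite -[f _]/(cdual_rmul f (H i) a).
apply: cfun_span_eq0 (span_symmon a) => _ [g [w ->]] /=.
rewrite -mulrA -[f _]/(cdual_lmul f (qps U g) _).
rewrite -[cdual_lmul _ _ _]/(cdual_rmul (cdual_lmul f (qps U g)) (H i) _).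
apply: cfun_span_eq0 (symmon_span w) => _ [v ->] /=.
have -> : Hw v * H i = Hw (rcons v i) by rewrite -cats1 big_cat big_seq1.
by apply: fw; case: v.
Qed.


(** The product of the word in the opposite of the convolution algebra. *)
Definition op_word (T : Type) (z : T -> cdual X) (w : seq T) : cdual X :=
  foldr (fun i f => conv Delta f (z i)) eps w.

Lemma conv_assoc f g k : conv Delta f (conv Delta g k) = conv Delta (conv Delta f g) k.
Proof. by apply: cdual_ext => a /=; rewrite comulA. Qed.

Lemma conv_counitl f : conv Delta eps f = f.
Proof. by apply: cdual_ext => a /=; rewrite counitl. Qed.

Section Generators.
Variables (eta : 'I_(dimH e) -> cdual X) (zeta : 'I_(dimV e) -> cdual X).
Hypothesis eta_basis : forall i v w,
  eta i (qbasis U v w) = ((v == [::]) && (w == [:: i]))%:R.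
Hypothesis zeta_basis : forall mu v w,
  zeta mu (qbasis U v w) = ((v == [:: mu]) && (w == [::]))%:R.
Local Notation zw w := (op_word zeta w).
Local Notation ew w := (op_word eta w).
Local Notation Hword := (fun w => Hw w).

(** * The generators of the dual *)

Lemma Xw_hX (f : cdual X) v t m :
  f (Xw v * hX t m) = \sum_(w : m.-tuple _) (\prod_(i <- w) t i) * f (qbasis U v w).
Proof.
rewrite (lcombX_symmon _ char0) mulr_sumr cfun_sum; apply: eq_bigr => w _.
by rewrite -scalerAr cfunZ.
Qed.

Lemma eta_monomial i v t m :
  eta i (Xw v * hX t m) = ((v == [::]) && (m == 1%N))%:R * t i.
Proof.
rewrite Xw_hX; case: v => [|mu v]; last first.
  by rewrite big1 ?mul0r // => w _; rewrite eta_basis mulr0.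
case: m => [|[|m]].
- by rewrite big1 ?mul0r // => w _; rewrite eta_basis tuple0 mulr0.
- rewrite (@sum_tupleS _ _ 0 (fun w => (\prod_(j <- w) t j) * eta i (qbasis U [::] w))).
  rewrite (bigD1 i) //= [X in _ + X]big1 ?addr0 => [|j ji].
    rewrite (@sum_tuple0 _ _ (fun w => (\prod_(j <- i :: w) t j) * eta i (qbasis U [::] (i :: w)))).
    by rewrite big_seq1 eta_basis !eqxx mulrC.
  by rewrite big1 // => w _; rewrite eta_basis eqseq_cons (negbTE ji) mulr0.
- rewrite big1 ?mul0r // => w _; rewrite eta_basis eqxx; case: eqP => [E|_]; last by rewrite mulr0.
  by have := size_tuple w; rewrite E.
Qed.

Lemma zeta_monomial mu v t m :
  zeta mu (Xw v * hX t m) = ((v == [:: mu]) && (m == 0%N))%:R.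
Proof.
rewrite Xw_hX; case: m => [|m].
  rewrite (@sum_tuple0 _ _ (fun w => (\prod_(j <- w) t j) * zeta mu (qbasis U v w))).
  by rewrite big_nil mul1r zeta_basis.
rewrite andbF big1 // => w _; rewrite zeta_basis [_ == [::]](_ : _ = false) ?andbF ?mulr0 //.
by apply/eqP => E; have := size_tuple w; rewrite E.
Qed.

Lemma kills_monomials n (f : cdual X) :
  (forall v t m, (n <= size v)%N -> f (Xw v * hX t m) = 0) -> kills X n f.
Proof.
move=> hf u hu; have [k hk] := cfun_cont f.
have [p hp hup] := adic_monomials k hu; rewrite (cfun_adic hk hup).
by apply: cfun_span_eq0 hp => _ [v [t [m [nv ->]]]]; apply: hf.
Qed.

Lemma eta_kills i : kills X 1 (eta i).
Proof. by apply: kills_monomials => -[|mu v] t m //; rewrite eta_monomial mul0r. Qed.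

Lemma zeta_kills mu : kills X 2 (zeta mu).
Proof.
by apply: kills_monomials => -[|nu [|nu' v]] t m //; rewrite zeta_monomial eqseq_cons andbF.
Qed.

Lemma eta_hX i t m : eta i (hX t m) = (m == 1%N)%:R * t i.
Proof. by have := eta_monomial i [::] t m; rewrite big_nil mul1r. Qed.

Lemma lcomb_delta j : lcomb H (fun i => (i == j)%:R) = H j.
Proof.
rewrite /lcomb (bigD1 j) //= eqxx scale1r big1 ?addr0 // => i /negbTE->.
by rewrite scale0r.
Qed.

Lemma eta_H i j : eta i (H j) = (i == j)%:R.
Proof. by have := eta_hX i (fun i => (i == j)%:R) 1; rewrite expr1 lcomb_delta mul1r. Qed.

Lemma eta_1 i : eta i 1 = 0.
Proof. by have := eta_hX i (fun=> 0) 0; rewrite expr0 mul0r. Qed.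

(** Counitality of Delta (H_i) in the first factor determines the constant
    terms of the coefficients. *)
Lemma counit_qexp i k : eps (qps U (qexp U i k)) = (i == k)%:R.
Proof.
have := counitl (qhopf U) (H i) (eta k); rewrite qcomulH /= ctens_sumE /=.
rewrite (@qcounitH _ _ _ _ U) mul0r addr0 (bigD1 k) //= eta_H eqxx mulr1 big1 ?addr0.
  by move=> ->; rewrite eta_H eq_sym.
by move=> j /negbTE; rewrite eta_H eq_sym => ->; rewrite mulr0.
Qed.

(** Modulo (X) in the first factor, the H_i are primitive. *)
Lemma conv_H N Z i b : kills X 1 N ->
  conv Delta N Z (H i * b) =
  conv Delta (cdual_lmul N (H i)) Z b + conv Delta N (cdual_lmul Z (H i)) b.
Proof.
move=> hN /=; rewrite comulM qcomulH mulrDl ctens_addE addrC ptensor_mulL mulr_suml ctens_sumE.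
congr (_ + _); first by congr (Delta b _ _); apply: cdual_ext => c /=; rewrite mul1r.
rewrite (eq_bigr (fun k => (i == k)%:R * Delta b N (cdual_lmul Z (H k)))) => [|k _]; last first.
  by rewrite ptensor_mulL (lmul_adic1 hN (qps_adic1 _)) counit_qexp ctensZl.
rewrite (bigD1 i) //= eqxx mul1r big1 ?addr0 // => k ki.
by rewrite eq_sym (negbTE ki) mul0r.
Qed.

Lemma lmul_lcomb (f : cdual X) t :
  cdual_lmul f (lcomb H t) = \sum_i t i *: cdual_lmul f (H i).
Proof.
apply: cdual_ext => b; rewrite cdual_sumE /= /lcomb mulr_suml cfun_sum.
by apply: eq_bigr => i _; rewrite -scalerAl cfunZ.
Qed.

Lemma conv_lcomb N Z t b : kills X 1 N ->
  conv Delta N Z (lcomb H t * b) =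
  conv Delta (cdual_lmul N (lcomb H t)) Z b + conv Delta N (cdual_lmul Z (lcomb H t)) b.
Proof.
move=> hN; rewrite /= !lmul_lcomb ctens_suml ctens_sumr -big_split /=.
rewrite /lcomb mulr_suml -[LHS]/(conv Delta N Z _) cfun_sum; apply: eq_bigr => i _.
by rewrite -scalerAl cfunZ conv_H //= mulrDr.
Qed.

Lemma conv_one N Z : conv Delta N Z 1 = N 1 * Z 1.
Proof. by rewrite /= comul1. Qed.

(** Since h is primitive modulo (X), the functional eta i acts on the powers of
    h as a derivation: eta i (h ^ c) is t_i for c = 1 and 0 otherwise. *)
Lemma conv_eta i Z v t m :
  conv Delta (eta i) Z (Xw v * hX t m) = m%:R * t i * Z (Xw v * hX t m.-1).
Proof.
set h := lcomb H t.
have [f Ef] := degH0P (degH_Xw v).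
rewrite {1}Ef conv_ps -?Ef; last exact: eta_kills.
set Z1 := cdual_lmul Z _; rewrite -[Z _]/(Z1 (h ^+ m.-1)).
have N_kills c : kills X 1 (cdual_lmul (eta i) (h ^+ c)) by apply/kills_lmul/eta_kills.
have N_mul c : cdual_lmul (cdual_lmul (eta i) (h ^+ c)) h = cdual_lmul (eta i) (h ^+ c.+1).
  by apply: cdual_ext => b /=; rewrite exprSr mulrA.
have N0 : eta i = cdual_lmul (eta i) (h ^+ 0) by apply: cdual_ext => b /=; rewrite expr0 mul1r.
have conv_h N Z' := @conv_lcomb N Z' t.
rewrite -/h in conv_h.
have h_eta : cdual_lmul (eta i) h = cdual_lmul (eta i) (h ^+ 1) by rewrite expr1.
have two c Z' k : conv Delta (cdual_lmul (eta i) (h ^+ c.+2)) Z' (h ^+ k) = 0.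
  elim: k c Z' => [|k IH] c Z'.
    by rewrite expr0 conv_one /= mulr1 eta_hX !mul0r.
  by rewrite (exprS h k) conv_h // N_mul !IH addr0.
have one Z' k : conv Delta (cdual_lmul (eta i) (h ^+ 1)) Z' (h ^+ k) = t i * Z' (h ^+ k).
  elim: k Z' => [|k IH] Z'.
    by rewrite expr0 conv_one /= mulr1 eta_hX mul1r.
  by rewrite (exprS h k) conv_h // IH N_mul two add0r /= -exprS.
elim: m Z1 => [|m IH] Z1; first by rewrite expr0 conv_one eta_1 !mul0r.
rewrite exprS conv_h; last exact: eta_kills.
rewrite h_eta one IH /=.
case: m {IH} => [|m] /=; first by rewrite !mul0r addr0 mul1r.
by rewrite -exprS -mulrDl -[X in X + _]mul1r -mulrDl -mulrS.
Qed.

Lemma zeta_killsUH mu : killsUH (zeta mu).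
Proof.
by apply: killsUH_monomials => v t m; rewrite zeta_monomial andbF.
Qed.

Lemma zeta_word_killsUH w : killsUH (op_word zeta w).
Proof.
by elim: w => [|mu w IH]; [exact: killsUH_counit | apply: killsUH_conv => //; exact: zeta_killsUH].
Qed.

(** A nonempty product of the zeta vanishes at 1 as each of them does. *)
Lemma zeta_word_1 w : op_word zeta w 1 = (w == [::])%:R.
Proof.
case: w => [|mu w]; first exact: counit1.
have := zeta_monomial mu [::] (fun=> 0) 0.
by rewrite big_nil mulr1 /= => h; rewrite comul1 /= h mulr0.
Qed.

Lemma conv_eta_word w Z v t m :
  conv Delta (op_word eta w) Z (Xw v * hX t m) =
  (m ^_ size w)%:R * (\prod_(i <- w) t i) * Z (Xw v * hX t (m - size w)).
Proof.
elim: w Z => [|i w IH] Z.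
  by rewrite conv_counitl big_nil ffactn0 !mul1r subn0.
rewrite -conv_assoc IH conv_eta big_cons /= ffactnSr natrM -subnS.
by rewrite [t i * _]mulrC -!mulrA; congr (_ * _); rewrite mulrCA.
Qed.

(** A product with at least n factors eta is evaluated on at most n - 1 factors
    H spread over them, so that one of the eta meets a power series. *)
Lemma adic_eta_degH n (c : (qdual U)^c) m u :
  adic (eta : _ -> (qdual U)^c) n c -> (m < n)%N -> degH m u -> qpair c u = 0.
Proof.
move=> hc; elim: hc m u => {n c} [c|n a i c _ IH|n|n a b _ ha _ hb] m u //.
- move=> mn hu; rewrite /qpair.
  rewrite -[LHS]/(Delta u (c : cdual X) (conv Delta (eta i) a)).
  have [k [hck hek]] := level (c : cdual X) (conv Delta (eta i) a).
  have [s [hs1 hs2]] := tensor_degH_comul hu k; rewrite hs1 //.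
  rewrite big_seq big1 // => q qs; have [j [j' [jj hj hj']]] := hs2 q qs.
  have [jn|nj] := ltnP j n.
    by have /= := IH j q.1 jn hj; rewrite /qpair => ->; rewrite mul0r.
  have j'0 : j' = 0%N.
    by apply/eqP; rewrite -leqn0 -(leq_add2l j) addn0 jj (leq_trans _ nj) // -ltnS.
  move: hj'; rewrite j'0 => /degH0P[f ->].
  by rewrite -[qps U f]mulr1 conv_ps ?conv_one ?eta_1 ?mul0r ?mulr0 //; exact: eta_kills.
- by move=> mn hu; have := ha m u mn hu; rewrite /qpair /= => ->; rewrite add0r; exact: hb mn hu.
Qed.

(** * Divided powers of the generic element *)

Lemma zeta_X mu nu : zeta mu (X nu) = (nu == mu)%:R.
Proof.
by have := zeta_monomial mu [:: nu] (fun=> 0) 0; rewrite big_seq1 mulr1 eqseq_cons !andbT.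
Qed.

Lemma zeta_1 mu : zeta mu 1 = 0.
Proof. by have := zeta_monomial mu [::] (fun=> 0) 0; rewrite big_nil mulr1. Qed.

(** zeta mu kills the square of the ideal (X). *)
Lemma zeta_derivation mu f g :
  zeta mu (qps U f * qps U g) =
  zeta mu (qps U f) * eps (qps U g) + eps (qps U f) * zeta mu (qps U g).
Proof.
set a := qps U f; set b := qps U g.
have : zeta mu ((a - (eps a)%:A) * (b - (eps b)%:A)) = 0.
  by apply: zeta_kills; apply: (@adicM _ _ _ _ 1 1); apply: qps_adic1.
rewrite mulrBl !mulrBr !mulr_algl !mulr_algr !cfunB !cfunZ zeta_1 !mulr0 subr0 => /eqP.
by rewrite subr_eq0 subr_eq => /eqP->; rewrite addrC [eps b * _]mulrC.
Qed.

(** The a-th divided power of the generic element sum zeta_mu (x) X^mu,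
    evaluated at u in the first factor. Its values are commuting power series,
    so that the symmetrization of the products of the zeta is automatic. *)
Definition dpow a (u : U) : U :=
  (a`!)%:R^-1 *: \sum_(w : a.-tuple 'I_(dimV e)) zw w u *: Xw w.

Lemma dpow_qps a u : exists f, dpow a u = qps U f.
Proof. by apply/degH0P/degHZ/degH_sum => w; apply/degHZ/degH_Xw. Qed.

Lemma dpowC a a' u u' : dpow a u * dpow a' u' = dpow a' u' * dpow a u.
Proof. by have [[f ->] [g ->]] := (dpow_qps a u, dpow_qps a' u'); exact: qpsC. Qed.

Lemma dpow0 u : dpow 0 u = (eps u)%:A.
Proof.
by rewrite /dpow invr1 scale1r (@sum_tuple0 _ _ (fun w => zw w u *: Xw w)) big_nil.
Qed.

Lemma zw1 mu : zw [:: mu] = zeta mu.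
Proof. exact: conv_counitl. Qed.

Lemma dpow1 u : dpow 1 u = \sum_mu zeta mu u *: X mu.
Proof.
rewrite /dpow invr1 scale1r (@sum_tupleS _ _ 0 (fun w => zw w u *: Xw w)).
apply: eq_bigr => mu _; rewrite (@sum_tuple0 _ _ (fun w => zw (mu :: w) u *: Xw (mu :: w))).
by rewrite zw1 big_seq1.
Qed.

Lemma dpow_1 a : dpow a.+1 1 = 0.
Proof.
rewrite /dpow big1 ?scaler0 // => w _; rewrite zeta_word_1.
by case: (tval w) (size_tuple w) => //= *; rewrite scale0r.
Qed.

Lemma zeta_word_level a : exists n, forall w, (size w <= a)%N -> kills X n (zw w).
Proof.
suff [n [_ hn]] : exists n, (1 < n)%N /\ forall w, (size w <= a)%N -> kills X n (zw w).
  by exists n.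
elim: a => [|a [n [n1 hn]]].
  by exists 2; split=> // -[|//] _; apply: killsW counit_adic1.
have [m hm] := comul_cont (qhopf U) n; exists (maxn n m); split; first by rewrite leq_max n1.
move=> w; rewrite leq_eqVlt => /orP[/eqP sw|sw]; last first.
  by apply: killsW (hn w sw); exact: leq_maxl.
apply: (killsW (leq_maxr n m)); case: w sw => // mu w [sw] c hc /=.
by apply: (hm c hc); [apply: hn; rewrite sw | apply: killsW n1 _; exact: zeta_kills].
Qed.

(** The analogue of dpow for a tensor; on a coproduct it computes the product of
    two divided powers. *)
Definition dpow2 i j (t : ctens X X) : U := (i`! * j`!)%:R^-1 *:
  \sum_(w : i.-tuple 'I_(dimV e)) \sum_(w' : j.-tuple 'I_(dimV e))
    t (zw w) (zw w') *: (Xw w' * Xw w).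

Lemma dpow2_linear i j : linear (dpow2 i j).
Proof.
move=> c t u; rewrite /dpow2 scalerA mulrC -scalerA -scalerDr; congr (_ *: _).
rewrite scaler_sumr -big_split; apply: eq_bigr => w _ /=.
rewrite scaler_sumr -big_split; apply: eq_bigr => w' _ /=.
by rewrite scalerDl scalerA.
Qed.

Lemma dpow2_approx n i j (t : ctens X X) s :
  (forall w, (size w <= maxn i j)%N -> kills X n (zw w)) -> approx n t s ->
  dpow2 i j t = \sum_(q <- s) dpow j q.2 * dpow i q.1.
Proof.
move=> hn hs; pose F (q : U * U) (w : i.-tuple 'I_(dimV e)) (w' : j.-tuple 'I_(dimV e)) :=
  (zw w q.1 * zw w' q.2) *: (Xw w' * Xw w).
have -> : dpow2 i j t =
    (i`! * j`!)%:R^-1 *: \sum_w \sum_w' \sum_(q <- s) F q w w'.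
  congr (_ *: _); apply: eq_bigr => w _; apply: eq_bigr => w' _; rewrite hs.
  - by rewrite scaler_suml.
  - by apply: hn; rewrite size_tuple leq_maxl.
  - by apply: hn; rewrite size_tuple leq_maxr.
under eq_bigr => w _ do rewrite exchange_big.
rewrite exchange_big scaler_sumr; apply: eq_bigr => q _ /=.
rewrite /dpow -scalerAl -scalerAr scalerA natrM invfM mulrC; congr (_ *: _).
rewrite mulr_suml exchange_big; apply: eq_bigr => w' _; rewrite mulr_sumr.
by apply: eq_bigr => w _; rewrite /F -scalerAl -scalerAr scalerA mulrC.
Qed.

(** The (a+1)-th power is the product of the a-th power and of the element. *)
Lemma dpowS a u : a.+1%:R *: dpow a.+1 u = dpow2 a 1 (Delta u).
Proof.
rewrite /dpow /dpow2 muln1 factS natrM invfM scalerA mulrA divff ?mul1r ?char0 //.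
congr (_ *: _); rewrite (@sum_tupleS _ _ a (fun w => zw w u *: Xw w)) exchange_big.
apply: eq_bigr => w _ /=.
rewrite (@sum_tupleS _ _ 0 (fun w' => Delta u (zw w) (zw w') *: (Xw w' * Xw w))).
apply: eq_bigr => mu _.
rewrite (@sum_tuple0 _ _ (fun w' => Delta u (zw w) (zw (mu :: w')) *: (Xw (mu :: w') * Xw w))).
by rewrite zw1 big_seq1 big_cons.
Qed.

Lemma dpow2_0 a u : dpow2 a 0 (Delta u) = dpow a u.
Proof.
rewrite /dpow /dpow2 muln1; congr (_ *: _); apply: eq_bigr => w _.
rewrite (@sum_tuple0 _ _ (fun w' => Delta u (zw w) (zw w') *: (Xw w' * Xw w))).
by rewrite big_nil mul1r /= counitr.
Qed.

(** The generating series of the divided powers is multiplicative. *)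
Definition leibniz a := forall f g, dpow a (qps U f * qps U g) =
  \sum_(i < a.+1) dpow i (qps U f) * dpow (a - i) (qps U g).

Lemma leibniz0 : leibniz 0.
Proof.
move=> f g; rewrite big_ord1 !dpow0 counitM.
by rewrite mulr_algl scalerA.
Qed.

Lemma leibniz1 : leibniz 1.
Proof.
move=> f g; rewrite big_ord_recl big_ord1 /= !dpow0 !dpow1 mulr_algl mulr_algr.
rewrite !scaler_sumr -big_split; apply: eq_bigr => mu _ /=.
by rewrite !scalerA -scalerDl zeta_derivation addrC [_ * eps _]mulrC.
Qed.

Lemma dpow2_mul i j t t' : leibniz i -> leibniz j -> tensor_degH 0 t -> tensor_degH 0 t' ->
  dpow2 i j (t * t') = \sum_(i' < i.+1) \sum_(j' < j.+1)
    dpow2 i' j' t * dpow2 (i - i') (j - j') t'.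
Proof.
move=> Li Lj ht ht'; have [n hn] := zeta_word_level (maxn i j).
have [s [hs1 hs2]] := ht n; have [s' [hs1' hs2']] := ht' n.
rewrite (dpow2_approx hn (approxM hs1 hs1')) big_allpairs_dep /=.
pose F (q q' : U * U) (i' j' : nat) :=
  (dpow j' q.2 * dpow i' q.1) * (dpow (j - j') q'.2 * dpow (i - i') q'.1).
transitivity (\sum_(q <- s) \sum_(q' <- s') \sum_(i' < i.+1) \sum_(j' < j.+1) F q q' i' j').
  apply: eq_big_seq => q qs; apply: eq_big_seq => q' qs'.
  have [i0 [j0 [/eqP + hi hj]]] := hs2 q qs.
  rewrite addn_eq0 => /andP[/eqP i00 /eqP j00].
  have [i1 [j1 [/eqP + hi' hj']]] := hs2' q' qs'.
  rewrite addn_eq0 => /andP[/eqP i10 /eqP j10].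
  subst i0 j0 i1 j1; have [[f1 E1] [f2 E2]] := (degH0P hi, degH0P hj).
  have [[g1 E1'] [g2 E2']] := (degH0P hi', degH0P hj').
  rewrite /F E1 E2 E1' E2' Li Lj mulr_sumr; apply: eq_bigr => i' _.
  rewrite mulr_suml; apply: eq_bigr => j' _.
  by rewrite -!mulrA; congr (_ * _); rewrite !mulrA; congr (_ * _); exact: dpowC.
rewrite (eq_bigr (fun q => \sum_(i' < i.+1) \sum_(q' <- s') \sum_(j' < j.+1) F q q' i' j'))
  => [|q _]; last exact: exchange_big.
rewrite exchange_big; apply: eq_bigr => i' _ /=.
rewrite (eq_bigr (fun q => \sum_(j' < j.+1) \sum_(q' <- s') F q q' i' j'))
  => [|q _]; last exact: exchange_big.
rewrite exchange_big; apply: eq_bigr => j' _ /=.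
have hi : (i' <= i)%N by rewrite -ltnS. have hj : (j' <= j)%N by rewrite -ltnS.
rewrite (dpow2_approx (n := n) _ hs1); last first.
  by move=> w hw; apply: hn; apply: leq_trans hw _; rewrite geq_max !leq_max hi hj orbT.
rewrite (dpow2_approx (n := n) _ hs1'); last first.
  by move=> w hw; apply: hn; apply: leq_trans hw _; rewrite geq_max !leq_max !leq_subr orbT.
by rewrite mulr_suml; apply: eq_bigr => q _; rewrite mulr_sumr.
Qed.

(** By induction on a: (a+1) dpow (a+1) of a product is computed from the
    coproduct by the rules for a and 1; splitting the factor a+1 as
    i + (a+1-i) on the other side gives the same sum. *)
Lemma leibnizP a : leibniz a.
Proof.
elim: a => [|a IH]; first exact: leibniz0.
move=> f g; apply: (@scalerI _ _ a.+1%:R); first exact: char0.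
rewrite dpowS comulM dpow2_mul //; try exact: tensor_degH_comul_qps; last exact: leibniz1.
under eq_bigr => i _ do rewrite big_ord_recl big_ord1 /= !dpow2_0 -!dpowS.
rewrite big_split /= addrC.
pose G i := dpow i (qps U f) * dpow (a.+1 - i) (qps U g).
rewrite -/(G _) scaler_sumr.
rewrite (eq_bigr (fun i : 'I_a.+2 => i%:R *: G i + (a.+1 - i)%:R *: G i)) => [|i _]; last first.
  by rewrite -scalerDl -natrD subnKC // -ltnS.
rewrite big_split /=; congr (_ + _).
  rewrite [RHS]big_ord_recl /= scale0r add0r; apply: eq_bigr => i _.
  by rewrite /G /bump /= add1n subSS scalerAl.
rewrite [RHS]big_ord_recr /= subnn scale0r addr0; apply: eq_bigr => i _.
by rewrite /G subSn ?scalerAr // -ltnS.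
Qed.

Lemma dpow2D i j t u : dpow2 i j (t + u) = dpow2 i j t + dpow2 i j u.
Proof. by have := dpow2_linear i j 1 t u; rewrite !scale1r. Qed.

Lemma dpow2_zero i j : dpow2 i j 0 = 0.
Proof. by apply: (addrI (dpow2 i j 0)); rewrite -dpow2D !addr0. Qed.

Lemma dpow2Z i j c t : dpow2 i j (c *: t) = c *: dpow2 i j t.
Proof. by have := dpow2_linear i j c t 0; rewrite dpow2_zero !addr0. Qed.

Lemma dpow2_tensor i j a b : dpow2 i j (a ⊗[X, X] b) = dpow j b * dpow i a.
Proof.
have [n hn] := zeta_word_level (maxn i j).
rewrite (dpow2_approx hn (@approx_ptensor _ _ _ _ _ X X n a b)).
by rewrite big_seq1.
Qed.

(** gam is antisymmetric in its lower indices and the X commute. *)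
Lemma gam_XX mu : \sum_rho \sum_sig gam rho sig mu *: (X rho * X sig) = 0.
Proof.
set S := LHS; have SN : S = - S.
  rewrite {1}/S exchange_big /S -sumrN; apply: eq_bigr => rho _; rewrite -sumrN.
  apply: eq_bigr => sig _; rewrite [gam sig rho mu]strg_antisym scaleNr.
  by rewrite [X sig * X rho](qpsXC (psX K sig)).
apply: (@scalerI _ _ 2%:R); first exact: char0.
by rewrite scaler0 scaler_nat mulr2n {1}SN addNr.
Qed.

Section Brackets.
Variable n : nat.
Hypothesis dpow_small : forall i nu, (i <= n)%N -> dpow i (X nu) = (i == 1%N)%:R *: X nu.

Let dpow2_ch_leaf b i j nu : (i <= n)%N -> (j <= n)%N -> dpow2 i j (ch_leaf b nu) =
  (if b then (i == 1%N) && (j == 0%N) else (i == 0%N) && (j == 1%N))%:R *: X nu.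
Proof.
move=> hi hj; case: b; rewrite /= dpow2_tensor.
  rewrite dpow_small //; case: j {hj} => [|j]; last first.
    by rewrite dpow_1 mul0r andbF scale0r.
  by rewrite dpow0 counit1 scale1r mul1r andbT.
rewrite dpow_small //; case: i {hi} => [|i]; last by rewrite dpow_1 mulr0 scale0r.
by rewrite dpow0 counit1 scale1r mulr1.
Qed.

(** The innermost bracket of two leaves is evaluated to a multiple of
    sum gam_(rho,sigma) X^rho X^sigma, hence to 0; an outer bracket multiplies
    values that vanish already. *)
Lemma dpow2_ch_nested bs mu i j : (i <= n)%N -> (j <= n)%N -> size bs != 1%N ->
  dpow2 i j (ch_nested gam (map ch_leaf bs) mu) = 0.
Proof.
elim: bs mu i j => [|b [|b' bs] IH] mu i j hi hj // _; first exact: dpow2_zero.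
have mul i' j' := dpow2_mul (leibnizP i') (leibnizP j').
rewrite ch_nested_leaves.
have sumE (F : 'I_(dimV e) -> ctens X X) : dpow2 i j (\sum_k F k) = \sum_k dpow2 i j (F k).
  by apply: (big_morph _ (dpow2D i j) (dpow2_zero i j)).
rewrite sumE; under eq_bigr => rho _ do rewrite sumE.
have sub (k l : nat) (k' : 'I_k.+1) : (k <= l)%N -> ((k' <= l)%N * (k - k' <= l)%N)%type.
  move=> kl; split; first by apply: leq_trans kl; rewrite -ltnS.
  by apply: leq_trans (leq_subr _ _) kl.
case: bs IH => [_|b'' bs IH]; last first.
  rewrite big1 // => rho _; rewrite big1 // => sig _.
  rewrite dpow2Z mul; [|exact: tensor_degH_ch_leaf|exact: tensor_degH_ch_nested].
  rewrite big1 ?scaler0 // => i' _; rewrite big1 // => j' _.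
  by rewrite IH ?mulr0 // (sub _ _ _ hi, sub _ _ _ hj).
pose c (b : bool) (i j : nat) : K :=
  (if b then (i == 1%N) && (j == 0%N) else (i == 0%N) && (j == 1%N))%:R.
rewrite (eq_bigr (fun rho =>
  (\sum_(i' < i.+1) \sum_(j' < j.+1) c b i' j' * c b' (i - i')%N (j - j')%N)
  *: \sum_sig gam rho sig mu *: (X rho * X sig))) => [|rho _].
  by rewrite -scaler_sumr gam_XX scaler0.
rewrite scaler_sumr; apply: eq_bigr => sig _.
rewrite dpow2Z mul; [|exact: tensor_degH_ch_leaf|exact: tensor_degH_ch_leaf].
rewrite scalerA mulrC -scalerA; congr (_ *: _).
rewrite scaler_suml; apply: eq_bigr => i' _; rewrite scaler_suml; apply: eq_bigr => j' _.
rewrite !dpow2_ch_leaf ?(sub _ _ _ hi, sub _ _ _ hj) //.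
by rewrite -scalerAl -scalerAr scalerA.
Qed.

End Brackets.

(** For a at least 2 the value comes from the Campbell-Hausdorff series: the
    brackets contribute nothing, and a leaf has a factor 1 on which a positive
    power vanishes. *)
Lemma dpow_X a mu : dpow a (X mu) = (a == 1%N)%:R *: X mu.
Proof.
elim/ltn_ind: a mu => -[|[|a]] IH mu.
- by rewrite dpow0 (@qcounitX _ _ _ _ U) !scale0r.
- rewrite dpow1 (bigD1 mu) //= zeta_X eqxx big1 ?addr0 // => nu.
  by rewrite zeta_X eq_sym => /negbTE->; rewrite scale0r.
apply: (@scalerI _ _ a.+2%:R); first exact: char0.
rewrite dpowS // scale0r scaler0.
have [n hn] := zeta_word_level (maxn a.+1 1).
have [t ht Gt] := comulX_lim n mu.
rewrite -(subrK t (Delta (X mu))) dpow2D.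
rewrite (dpow2_approx (s := [::]) hn) => [|f g hf hg]; last by rewrite big_nil ht.
rewrite big_nil add0r; apply: (Gt (fun t => dpow2 a.+1 1 t = 0)) => [|u v hu hv|c u hu|bs].
- exact: dpow2_zero.
- by rewrite dpow2D hu hv addr0.
- by rewrite dpow2Z hu scaler0.
have [|] := eqVneq (size bs) 1%N.
  case: bs => [|[] [|]] //= _; rewrite dpow2_tensor.
    by rewrite dpow_1 mul0r.
  by rewrite dpow_1 mulr0.
by apply: (@dpow2_ch_nested a.+1) => // i nu hi; apply: IH.
Qed.

Lemma dpow_Xw a v : dpow a (Xw v) = (a == size v)%:R *: Xw v.
Proof.
elim: v a => [|mu v IH] a.
  case: a => [|a]; first by rewrite big_nil dpow0 counit1.
  by rewrite big_nil dpow_1 scale0r.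
have [f Ef] := degH0P (degH_Xw v).
rewrite big_cons {1}Ef (leibnizP) -Ef.
have -> : qps U (psX K mu) = X mu by [].
rewrite (eq_bigr (fun i : 'I_a.+1 =>
  ((i : nat) == 1%N)%:R *: X mu * (((a - i)%N == size v)%:R *: Xw v)))
  => [|i _]; last by rewrite dpow_X IH.
case: a => [|a]; first by rewrite big_ord1 !scale0r mul0r.
rewrite big_ord_recl /= scale0r mul0r add0r big_ord_recl /= scale1r subSS subn0 eqSS.
rewrite [Y in _ + Y]big1 ?addr0 => [|i _]; first by rewrite -scalerAr.
by rewrite /bump /= scale0r mul0r.
Qed.

(** * Expansion along the generators of the dual *)

Lemma killsUH_hX (f : cdual X) a t m : killsUH f -> f (a * hX t m.+1) = 0.
Proof.
move=> hf; rewrite exprSr mulrA /lcomb mulr_sumr cfun_sum big1 // => i _.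
by rewrite -scalerAr cfunZ hf mulr0.
Qed.

(** The product of the exponentials, truncated and evaluated at u in the first
    factor. The word of the H in the second factor is replaced by an arbitrary
    function k of the word, for the use in [adic_eta_converse]. *)
Definition expansion (k : seq 'I_(dimH e) -> U) n m (u : U) : U :=
  \sum_(a < n) \sum_(b < m)
    \sum_(w : a.-tuple 'I_(dimV e)) \sum_(w' : b.-tuple 'I_(dimH e))
      ((a`! * b`!)%:R^-1 * conv Delta (ew w') (zw w) u) *: (Xw w * k w').

Lemma expansion_linear k n m : linear (expansion k n m).
Proof.
have sum_lin (T : Type) (r : seq T) (F : T -> U -> U) :
    (forall j, linear (F j)) -> linear (fun u => \sum_(j <- r) F j u).
  move=> hF c u v; rewrite scaler_sumr -big_split; apply: eq_bigr => j _.
  exact: hF.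
do 4![apply: (sum_lin _ _ _ _) => ?] => c u v.
by rewrite cfunD cfunZ mulrDr mulrCA scalerDl scalerA.
Qed.

Lemma expansion_cont k n m : exists l, forall u, adicX l u -> expansion k n m u = 0.
Proof.
have sum_cont (T : Type) (r : seq T) (F : T -> U -> U) :
    (forall j, exists l, forall u, adicX l u -> F j u = 0) ->
    exists l, forall u, adicX l u -> \sum_(j <- r) F j u = 0.
  move=> hF; elim: r => [|j r [l hl]]; first by exists 0%N => u _; rewrite big_nil.
  have [l' hl'] := hF j; exists (maxn l l') => u hu; rewrite big_cons.
  by rewrite (hl' _ (adicW (leq_maxr _ _) hu)) (hl _ (adicW (leq_maxl _ _) hu)) addr0.
do 4![apply: (sum_cont _ _ _ _) => ?].
set f := conv _ _ _; have [l hl] := cfun_cont f; exists l => u hu.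
by rewrite hl // mulr0 scale0r.
Qed.

(** The eta take away powers of h by [conv_eta_word], all of them as the zeta
    kill what contains an H; the zeta then recover X^v by [dpow_Xw]. *)
Lemma expansion_monomial k n m v t j :
  expansion k n m (Xw v * hX t j) =
  ((size v < n) && (j < m))%N%:R *:
    (Xw v * \sum_(w : j.-tuple 'I_(dimH e)) (\prod_(i <- w) t i) *: k w).
Proof.
pose S := \sum_(w : j.-tuple 'I_(dimH e)) (\prod_(i <- w) t i) *: k w.
have term a b : \sum_(w : a.-tuple 'I_(dimV e)) \sum_(w' : b.-tuple 'I_(dimH e))
    ((a`! * b`!)%:R^-1 * conv Delta (ew w') (zw w) (Xw v * hX t j)) *: (Xw w * k w') =
    ((a == size v) && (b == j))%:R *: (Xw v * S).
  have [->|bj] := eqVneq b j; last first.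
    rewrite andbF scale0r big1 // => w _; rewrite big1 // => w' _.
    rewrite conv_eta_word size_tuple.
    case: (ltngtP b j) bj => // [bj|jb] _.
      rewrite -(prednK (_ : 0 < j - b)%N) ?subn_gt0 //.
      by rewrite (killsUH_hX _ _ _ (zeta_word_killsUH w)) !mulr0 scale0r.
    by rewrite ffact_small // !mul0r mulr0 scale0r.
  rewrite andbT.
  have := dpow_Xw a v; rewrite /dpow => E.
  rewrite [RHS]scalerAl -E -scalerAl mulr_suml scaler_sumr; apply: eq_bigr => w _.
  rewrite /S mulr_sumr scaler_sumr; apply: eq_bigr => w' _.
  rewrite conv_eta_word size_tuple subnn expr0 mulr1 ffactnn.
  rewrite -scalerAl -scalerAr !scalerA; congr (_ *: _).
  rewrite natrM invfM -!mulrA; congr (_ * _).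
  by rewrite mulKf ?(fact_neq0 char0) // mulrC.
transitivity (\sum_(a < n) \sum_(b < m) ((a == size v :> nat) && (b == j :> nat))%:R *: (Xw v * S)).
  by apply: eq_bigr => a _; apply: eq_bigr => b _; exact: term.
rewrite (eq_bigr (fun a : 'I_n =>
  (\sum_(b < m) ((a == size v :> nat) && (b == j :> nat))%:R) *: (Xw v * S)))
  => [|a _]; last by rewrite scaler_suml.
rewrite -scaler_suml; congr (_ *: _).
have [vn|nv] := ltnP (size v) n; last first.
  rewrite big1 // => a _; rewrite big1 // => b _.
  by rewrite ltn_eqF // (leq_trans (ltn_ord a)).
rewrite (bigD1 (Ordinal vn)) //= [Y in _ + Y]big1 ?addr0 => [|a /negbTE av]; last first.
  by rewrite big1 // => b _; rewrite -[_ == size v]/(a == Ordinal vn) av.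
have [jm|mj] := ltnP j m; last first.
  rewrite big1 // => b _; rewrite andbC ltn_eqF // (leq_trans (ltn_ord b)) //.
rewrite (bigD1 (Ordinal jm)) //= [Y in _ + Y]big1 ?addr0 ?eqxx // => b /negbTE bj.
by rewrite -[_ == j]/(b == Ordinal jm) bj andbF.
Qed.

Lemma linear_span_eq0 (f : U -> U) (G : U -> Prop) u :
  linear f -> (forall g, G g -> f g = 0) -> span G u -> f u = 0.
Proof.
move=> lf hG; elim=> [|c g v hg _ IH].
  by have := lf (-1) 0 0; rewrite scaler0 addr0 scaleN1r addNr.
by rewrite lf hG // IH scaler0 addr0.
Qed.

Lemma linear_sub (f : U -> U) u v : linear f -> f (u - v) = f u - f v.
Proof. by move=> lf; rewrite addrC -scaleN1r lf scaleN1r addrC. Qed.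

(** By density it suffices to look at X^v h^j with at least n factors X, on
    which the truncation to less than n factors zeta vanishes. *)
Lemma expansion_adic k n m u : adicX n u -> expansion k n m u = 0.
Proof.
move=> hu; have [l hl] := expansion_cont k n m.
have lin := expansion_linear k n m.
have [p hp hup] := adic_monomials l hu.
have /eqP := hl _ hup; rewrite linear_sub // subr_eq0 => /eqP->.
apply: linear_span_eq0 hp => // _ [v [t [j [nv ->]]]].
by rewrite expansion_monomial ltnNge nv scale0r.
Qed.


(** At X^v h^j the expansion is exact if v has less than n letters and j is less
    than m; if v has n letters or more, X^v h^j and its expansion are 0 modulo the
    n-th power of (X). Finitely many j occur in u modulo that power. *)
Lemma expansion_approx n u : exists m0, forall m, (m0 <= m)%N ->
  adicX n (u - expansion Hword n m u).
Proof.
have lin m := expansion_linear Hword n m.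
have [p hp hu] : approx_span (monomial 0) n u.
  by apply: adic_monomials => //; exact: adic_all.
suff [m0 hm0] : exists m0, forall m, (m0 <= m)%N -> adicX n (p - expansion Hword n m p).
  exists m0 => m mm; have := hm0 m mm.
  have /eqP := expansion_adic Hword m hu; rewrite linear_sub // subr_eq0 => /eqP->.
  by move/(adicD hu); rewrite addrA subrK.
elim: hp => [|c _ q [v [t [j [_ ->]]]] _ [m0 IH]].
  exists 0%N => m _; rewrite sub0r; have := lin m (-1) 0 0.
  by rewrite scaler0 addr0 scaleN1r addNr => ->; rewrite oppr0; exact: adic0.
exists (maxn j.+1 m0) => m; rewrite geq_max => /andP[jm m0m].
rewrite lin opprD addrACA -scalerBr; apply: adicD (IH _ m0m); apply: adicZ.
rewrite expansion_monomial jm andbT -lcombX_words.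
have [vn|nv] := ltnP (size v) n; first by rewrite scale1r subrr; exact: adic0.
rewrite scale0r subr0; apply: adicMr; apply: (adicW nv).
by have := @adic_word _ _ _ X 0 v 1 (adic_all _ _); rewrite addn0 mulr1.
Qed.

Lemma compose_cdual (f : U -> U) (phi : cdual X) : linear f ->
  (exists l, forall u, adicX l u -> f u = 0) ->
  exists psi : cdual X, forall u, psi u = phi (f u).
Proof.
move=> lf [l hl].
have lin : scalar (fun u => phi (f u)) by move=> c u v; rewrite lf cfunD cfunZ.
have cont : exists n, kills X n (fun u => phi (f u)).
  by exists l => u hu; rewrite hl // cfun0.
by exists (CDual lin cont).
Qed.

(** Composed with the truncated expansion R, the coefficients of R kill the
    n-th power of (X), so they vanish at u, that is, R (R u) = 0. But R u and u
    are congruent modulo that power, which R kills, so R u = R (R u) = 0. *)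
Lemma kills_separate n u :
  (forall g : cdual X, kills X n g -> g u = 0) -> adicX n u.
Proof.
move=> hu; have [m /(_ m (leqnn m)) hm] := expansion_approx n u.
set R := expansion Hword n m in hm.
have lR : linear R := expansion_linear Hword n m.
have R0 phi : (phi : cdual X) (R u) = 0.
  have [psi hpsi] := compose_cdual phi lR (expansion_cont Hword n m).
  rewrite -hpsi; apply: hu => a ha; rewrite hpsi.
  by rewrite /R expansion_adic // cfun0.
have RR : R (R u) = 0.
  rewrite {1}/R /expansion; do 4![rewrite big1 // => ? _].
  by rewrite R0 mulr0 scale0r.
have Ru : R u = 0.
  have := expansion_adic Hword m hm; rewrite -/R linear_sub // RR subr0.
  exact.
by rewrite Ru subr0 in hm.
Qed.

(** * The powers of the ideal of the eta *)

Lemma op_word_prod (T : Type) (z : T -> cdual X) w :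
  (\prod_(i <- w) (z i : (qdual U)^c) : (qdual U)^c) = op_word z w.
Proof. by elim: w => [|i w IH]; rewrite ?big_nil // big_cons IH. Qed.

Lemma eta_word_degH w Z m u : degH m u -> (m < size w)%N -> Delta u (ew w) Z = 0.
Proof.
move=> hu mw; pose c : (qdual U)^c := (Z : (qdual U)^c) * \prod_(i <- w) (eta i : (qdual U)^c).
have -> : Delta u (ew w) Z = qpair c u by rewrite /c op_word_prod.
apply: (adic_eta_degH (n := size w)) hu => //.
apply: adicMl; rewrite -[\prod_(_ <- _) _]mulr1 -[size w]addn0.
by apply: adic_word; exact: adic_all.
Qed.

Lemma expansion_stable k n j u m m' : degH j u -> (j < m)%N -> (j < m')%N ->
  expansion k n m u = expansion k n m' u.
Proof.
move=> hu jm; wlog mm : m m' jm / (m <= m')%N => [hw jm'|].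
  by have [/hw->//|/ltnW/hw->] := leqP m m'.
move=> _; rewrite -(subnK mm); elim: (m' - m)%N => [//|l ->].
apply: eq_bigr => a _; rewrite addSn big_ord_recr /= [Y in _ + Y]big1 ?addr0 // => w _.
rewrite big1 // => w' _; rewrite (eta_word_degH _ hu) ?mulr0 ?scale0r //.
by rewrite size_tuple (leq_trans jm) ?leq_addl.
Qed.

Lemma degH_hX t m : degH m (hX t m).
Proof.
elim: m => [|m IH]; first exact: degH_one.
rewrite exprS -add1n; apply: degHM IH.
by apply: degH_sum => i; apply/degHZ/degH_gen.
Qed.

(** On the elements X^v h^m the functional d is a polynomial in t, homogeneous
    of degree m, and eta i acts as the multiplication by m t_i. Euler's formula
    writes m d as the sum of the t_i times the partial derivatives of d; this
    gives d as the sum of the eta i times functionals dv i, where dv i is the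
    value of d at X^v times the symmetrization of h^(m-1) H_i, divided by m.
    The expansion above provides the dv i as functionals on the whole algebra.
    They vanish on one degree less than d does. *)
Lemma adic_eta_converse n (d : cdual X) :
  (forall m u, (m < n)%N -> degH m u -> d u = 0) ->
  adic (eta : _ -> (qdual U)^c) n (d : (qdual U)^c).
Proof.
elim: n d => [|n IH] d hd; first exact: adic_all.
have [n0 hn0] := cfun_cont d.
pose k i (w : seq 'I_(dimH e)) : U := (size w).+1%:R^-1 *: symmon H (i :: w).
pose E i m (u : U) := d (expansion (k i) n0 m u).
pose deg (u : U) := sval (cid (degH_exists u)).
have degP u : degH (deg u) u by rewrite /deg; case: cid.
pose dv i (u : U) := E i (deg u).+1 u.
have dvE i m u j : degH j u -> (j < m)%N -> dv i u = E i m u.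
  move=> hu jm; rewrite /dv /E; congr (d _).
  set M := maxn m (deg u).+1.
  rewrite (@expansion_stable (k i) n0 (deg u) u (deg u).+1 M) ?leq_maxr ?degP //.
  by rewrite (@expansion_stable (k i) n0 j u M m) // leq_max jm.
have dv_lin i : scalar (dv i).
  move=> c u v; set j := maxn (deg u) (deg v).
  have hu : degH j u by apply: degHW (degP u); exact: leq_maxl.
  have hv : degH j v by apply: degHW (degP v); exact: leq_maxr.
  have huv : degH j (c *: u + v) by apply: degH_add => //; apply: degHZ.
  rewrite !(dvE i j.+1 _ j) // /E expansion_linear cfunD cfunZ //.
have dv_kills i : kills X n0 (dv i).
  by move=> u hu; rewrite /dv /E expansion_adic ?cfun0.
pose D i := CDual (dv_lin i) (ex_intro _ n0 (dv_kills i)).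
have -> : d = \sum_i conv Delta (eta i) (D i) :> cdual X.
  apply: cdual_ext_monomials => v t [|m]; rewrite cdual_sumE.
    rewrite [RHS]big1 => [|i _]; last by rewrite conv_eta !mul0r.
    by apply: (hd 0%N) => //; rewrite expr0 mulr1; exact: degH_Xw.
  have hdeg : degH m (Xw v * hX t m).
    by rewrite -[m in degH m]add0n; apply: degHM; [exact: degH_Xw | exact: degH_hX].
  pose S i : U := \sum_(w : m.-tuple 'I_(dimH e)) (\prod_(j <- w) t j) *: symmon H (i :: w).
  rewrite (eq_bigr (fun i => (size v < n0)%N%:R * (t i * d (Xw v * S i)))) => [|i _]; last first.
    rewrite conv_eta /= (dvE i m.+1 _ m) // /E.
    rewrite expansion_monomial ltnSn andbT cfunZ.
    set Y := Xw v * _; have <- : m.+1%:R * d Y = d (Xw v * S i).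
      rewrite -cfunZ /Y scalerAr scaler_sumr; congr (d (_ * _)); apply: eq_bigr => w _.
      by rewrite /k size_tuple scalerA [LHS]scalerA mulrAC mulfV ?mul1r ?char0.
    by rewrite [LHS]mulrCA -mulrA; congr (_ * _); exact: mulrCA.
  rewrite -mulr_sumr; have [vn|nv] := ltnP (size v) n0; last first.
    rewrite mul0r; apply: hn0; apply: adicMr; apply: (adicW nv).
    by have := @adic_word _ _ _ X 0 v 1 (adic_all _ _); rewrite addn0 mulr1.
  rewrite mul1r (lcombX_symmon _ char0).
  rewrite (@sum_tupleS _ _ m (fun w => (\prod_(i <- w) t i) *: symmon H w)).
  rewrite mulr_sumr cfun_sum; apply: eq_bigr => i _.
  rewrite -cfunZ scalerAr /S scaler_sumr; congr (d (_ * _)); apply: eq_bigr => w _.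
  by rewrite [RHS]scalerA big_cons.
apply: (@adic_sum _ _ _ (eta : _ -> (qdual U)^c)) => i _.
rewrite -[conv _ _ _]/((D i : (qdual U)^c) * (eta i : (qdual U)^c)) -addn1.
apply: adicM; last first.
  have := @adic_gen _ _ _ (eta : _ -> (qdual U)^c) 0 1 i 1 (adic_all _ 1).
  by rewrite mul1r mulr1.
apply: IH => m u mn hu; rewrite -[D i u]/(dv i u) (dvE i m.+1 _ m) // /E cfun_sum big1 // => a _.
rewrite cfun_sum big1 // => b _; rewrite cfun_sum big1 // => w _; rewrite cfun_sum big1 // => w' _.
rewrite cfunZ (hd b.+1) ?mulr0 //; first by rewrite ltnS (leq_trans (ltn_ord b)).
rewrite -[b.+1]add0n; apply: degHM; first exact: degH_Xw.
apply: degHZ; have := degH_symmon (i :: w').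
by rewrite /= size_tuple.
Qed.

End Generators.
End Quantization.

(** * The canonical element *)

Section CanonicalElement.
Variables (K : fieldType) (L : vectType K) (B : objB L) (e : adapted_basis B).
Variable U : quantization e.
Hypothesis char0 : forall n, n.+1%:R != 0 :> K.
Local Notation X := (qX U).
Local Notation H := (qH U).
Local Notation Hword := (fun w => \prod_(i <- w) qH U i).
Local Notation D := ((qdual U)^c)%type.
Variables (eta : 'I_(dimH e) -> (qdual U)^c) (zeta : 'I_(dimV e) -> (qdual U)^c).
Hypothesis eta_basis : forall i v w,
  qpair (eta i) (qbasis U v w) = ((v == [::]) && (w == [:: i]))%:R.
Hypothesis zeta_basis : forall mu v w,
  qpair (zeta mu) (qbasis U v w) = ((v == [:: mu]) && (w == [::]))%:R.

Local Notation zX := (\sum_mu zeta mu ⊗[eta, X] X mu).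
Local Notation eH := (\sum_i eta i ⊗[eta, X] H i).

Lemma zX_null n m : (n <= m)%N -> tnull n (zX ^+ m).
Proof.
move=> nm f g hf hg; rewrite ptensor_expr_sum ctens_sumE big1 // => w _ /=.
rewrite (hg (\prod_(i <- w) X i)) ?mulr0 //; apply: (adicW nm).
by have := @adic_word _ _ _ X 0 w 1 (adic_all _ _); rewrite addn0 mulr1 size_tuple.
Qed.

Lemma eH_null n m : (n <= m)%N -> tnull n (eH ^+ m).
Proof.
move=> nm f g hf hg; rewrite ptensor_expr_sum ctens_sumE big1 // => w _ /=.
rewrite (hf (\prod_(i <- w) eta i)) ?mul0r //; apply: (adicW nm).
by have := @adic_word _ _ _ eta 0 w 1 (adic_all _ _); rewrite addn0 mulr1 size_tuple.
Qed.

Lemma qeval_linear u : scalar (fun c : D => qpair c u).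
Proof. by []. Qed.

Lemma qeval_kills n m u : degH m u -> (m < n)%N -> kills eta n (fun c : D => qpair c u).
Proof. by move=> hu mn c hc; exact: (adic_eta_degH char0 eta_basis hc mn hu). Qed.

Lemma qeval_cont u : exists n, kills eta n (fun c : D => qpair c u).
Proof. by have [m hm] := degH_exists char0 u; exists m.+1; apply: qeval_kills hm _. Qed.

(** Evaluation at u on the dual algebra; it is continuous by
    [adic_eta_degH]. *)
Definition qeval u : cdual eta := CDual (qeval_linear u) (qeval_cont u).

Lemma cexp_qeval u g : (cexp zX * cexp eH) (qeval u) g = g u.
Proof.
have [n [hf hg]] := level (qeval u) g.
have [m hm] := expansion_approx char0 eta_basis zeta_basis n u.
rewrite (cexp_mulE zX_null eH_null hf hg (killsW (leq_maxl n m) hf) (killsW (leq_maxl n m) hg)).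
rewrite -[RHS](subrK (g (expansion eta zeta Hword n (maxn n m) u))) -cfunB.
rewrite hg ?add0r; last by apply: hm; exact: leq_maxr.
rewrite /expansion cfun_sum; apply: eq_bigr => a _; rewrite cfun_sum; apply: eq_bigr => b _.
rewrite cfun_sum; apply: eq_bigr => w _; rewrite cfun_sum; apply: eq_bigr => w' _.
rewrite cfunZ; congr (_ * _ * _).
by rewrite -[LHS]/(qpair _ u) !op_word_prod.
Qed.

Lemma canonical_cexp : canonical_element (cexp zX * cexp eH).
Proof.
move=> u n; have [m hm] := cfun_cont (qeval u).
exists (maxn n m) => s hs; apply: (kills_separate char0 eta_basis zeta_basis) => g hg.
rewrite cfunB cfun_sum -(cexp_qeval u) hs.
- by rewrite -sumrB big1 // => p _; rewrite cfunZ subrr.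
- exact: killsW (leq_maxr n m) hm.
- exact: killsW (leq_maxl n m) hg.
Qed.

Lemma canonical_qeval (T : ctens eta X) u g : canonical_element T -> T (qeval u) g = g u.
Proof.
move=> hT; have [n [hf hg]] := level (qeval u) g; have [m hm] := hT u n.
have [s hs] := cvalP T (maxn n m).
have := hg _ (hm s (approxW (leq_maxr n m) hs)); rewrite cfunB cfun_sum => /eqP.
rewrite subr_eq0 => /eqP->.
rewrite hs; [|exact: killsW (leq_maxl n m) hf|exact: killsW (leq_maxl n m) hg].
by apply: eq_bigr => p _; rewrite cfunZ.
Qed.

(** Two canonical elements agree on the evaluations at all u. By
    [adic_eta_converse] these determine a functional on the dual modulo the
    n-th power of the ideal of the eta. *)
Lemma canonical_unique (T T' : ctens eta X) :
  canonical_element T -> canonical_element T' -> T = T'.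
Proof.
move=> hT hT'; apply: ctens_ext => f g; have [n [hf hg]] := level f g.
have [s hs] := cvalP T n; have [s' hs'] := cvalP T' n.
pose d (r : seq (D * U)) : D := \sum_(p <- r) g p.2 *: p.1.
have fd r : f (d r) = \sum_(p <- r) f p.1 * g p.2.
  by rewrite cfun_sum; apply: eq_bigr => p _; rewrite cfunZ mulrC.
have ud r u : qpair (d r) u = \sum_(p <- r) qpair p.1 u * g p.2.
  rewrite /d /qpair -[LHS]/(qeval u (d r)) cfun_sum; apply: eq_bigr => p _.
  by rewrite cfunZ mulrC.
rewrite hs // hs' // -!fd; apply: (cfun_adic hf).
apply: (adic_eta_converse char0 eta_basis zeta_basis) => m u mn hu.
have hu' := qeval_kills hu mn.
rewrite -[LHS]/(qeval u (d s - d s')) cfunB -[qeval u _]/(qpair _ u) -[qeval u (d s')]/(qpair _ u).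
have := canonical_qeval u g hT; have := canonical_qeval u g hT'; rewrite hs // hs' // => E' E.
by rewrite !ud E E' subrr.
Qed.

Lemma canonicalP (T : ctens eta X) :
  canonical_element T <-> T = cexp zX * cexp eH.
Proof.
split=> [hT|->]; last exact: canonical_cexp.
exact: canonical_unique hT canonical_cexp.
Qed.

End CanonicalElement.

Lemma ground_field_char0 (R : realType) (k : ground) n : n.+1%:R != 0 :> ground_field R k.
Proof.
case: k => /=; first by rewrite Num.Theory.pnatr_eq0.
exact: negbT (Num.Theory.pnatr_eq0 R[i] n.+1).
Qed.

Theorem mainTheorem4 (R : realType) (k : ground)
    (L : vectType (ground_field R k)) (B : objB L) (e : adapted_basis B)
    (U : quantization e)
    (eta : 'I_(dimH e) -> (qdual U)^c) (zeta : 'I_(dimV e) -> (qdual U)^c)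
    (eta_basis : forall i v w,
       qpair (eta i) (qbasis U v w) = ((v == [::]) && (w == [:: i]))%:R)
    (zeta_basis : forall mu v w,
       qpair (zeta mu) (qbasis U v w) = ((v == [:: mu]) && (w == [::]))%:R)
    (T : ctens eta (qX U)) :
  canonical_element T <->
  T = cexp (\sum_mu zeta mu ⊗[eta, qX U] qX U mu)
      * cexp (\sum_i eta i ⊗[eta, qX U] qH U i).
Proof. exact: (canonicalP (@ground_field_char0 R k) eta_basis zeta_basis). Qed.
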